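(* The categorically surjective topology $\tau'$ on $\mathbf{Cat}$ determines a model structure $$(\mathsf{Cat}(\mathbf{Cat}),\mathsf{we}(\tau'),\mathsf{fib}(\tau'),\mathsf{cof}(\tau'))$$ on $\mathsf{Cat}(\mathbf{Cat})=\mathbf{DblCat}$; that is, the $\tau'$-equivalences, $\tau'$-fibrations and $\tau'$-cofibrations are respectively the weak equivalences, fibrations and cofibrations of a model structure on the category of small double categories and double functors.
   Context: $\mathsf{Cat}(\mathbf{Cat})=\mathbf{DblCat}$ is the category of internal categories in $\mathbf{Cat}$ (small double categories) and internal functors (double functors). A double category $\mathbb{B}$ has a category $\mathbb{B}_0$ of objects and vertical morphisms and a category $\mathbb{B}_1$ of horizontal morphisms and squares (composed vertically), with horizontal source and target functors $s,t:\mathbb{B}_1\to\mathbb{B}_0$. Topology $\tau'$: a functor is categorically surjective if it is surjective on objects and full. The singletons $\{F:\mathbf{D}\to\mathbf{C}\}$ with $F$ categorically surjective form a basis for a Grothendieck topology $\tau'$ on $\mathbf{Cat}$. For a Grothendieck topology $\mathcal{T}$ on $\mathbf{Cat}$: a functor $p:\mathbf{E}\to\mathbf{B}$ is $\mathcal{T}$-epi if its image under the Yoneda embedding followed by sheafification is an epimorphism of sheaves; equivalently, for every functor $g:\mathbf{X}\to\mathbf{B}$ there are a covering family $\{f_i:\mathbf{U}_i\to\mathbf{X}\}_i$ (from a basis for $\mathcal T$) and functors $u_i:\mathbf{U}_i\to\mathbf{E}$ with $pu_i=gf_i$ for all $i$. For a double category $\mathbb{B}$ let $\mathsf{iso}(\mathbb{B})_1\subseteq\mathbb{B}_1$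 be the subcategory of invertible horizontal morphisms and horizontally invertible squares. For a double functor $F:\mathbb{A}\to\mathbb{B}$ let $(\mathbb{P}_F)_0=\mathbb{A}_0\times_{\mathbb{B}_0}\mathsf{iso}(\mathbb{B})_1$ be the pullback of $F_0:\mathbb{A}_0\to\mathbb{B}_0$ and $t:\mathsf{iso}(\mathbb{B})_1\to\mathbb{B}_0$, with projection $\overline F_0:(\mathbb{P}_F)_0\to\mathsf{iso}(\mathbb{B})_1$. - $F$ is essentially $\mathcal{T}$-surjective if $s\circ\overline F_0:(\mathbb{P}_F)_0\to\mathbb{B}_0$ is $\mathcal{T}$-epi; $F$ is fully faithful if the square formed by $F_1$, $F_0\times F_0$ and the functors $(s,t):\mathbb{A}_1\to\mathbb{A}_0\times\mathbb{A}_0$, $(s,t):\mathbb{B}_1\to\mathbb{B}_0\times\mathbb{B}_0$ is a pullback in $\mathbf{Cat}$. $F$ is a $\mathcal{T}$-equivalence (class $\mathsf{we}(\mathcal{T})$) if it is fully faithful and essentially $\mathcal{T}$-surjective. - $F$ is a $\mathcal{T}$-fibration (class $\mathsf{fib}(\mathcal{T})$) if the functor $(r_F)_0:\mathsf{iso}(\mathbb{A})_1\to(\mathbb{P}_F)_0$ induced by $t:\mathsf{iso}(\mathbb{A})_1\to\mathbb{A}_0$ and $\mathsf{iso}(F)_1$ is $\mathcal{T}$-epi. - $F$ is a $\mathcal{T}$-cofibration (class $\mathsf{cof}(\mathcal{T})$) if it has the left lifting property with respect to all double functors that are both $\mathcal{T}$-fibrations and $\mathcal{T}$-equivalences. *)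

(* Defs.v *)
From Stdlib Require Import ProofIrrelevance FunctionalExtensionality.

Set Implicit Arguments.

(** * Categories and model structures *)

(* Large categories, used for [Cat] and [DblCat] themselves.  Morphisms are
   indexed by source and target and compared with Leibniz equality. *)
Record category := Category {
  obj : Type;
  hom : obj -> obj -> Type;
  idc : forall X, hom X X;
  compc : forall X Y Z, hom Y Z -> hom X Y -> hom X Z;
  compc_idl : forall X Y (f : hom X Y), compc (idc Y) f = f;
  compc_idr : forall X Y (f : hom X Y), compc f (idc X) = f;
  compc_assoc : forall X Y Z W (h : hom Z W) (g : hom Y Z) (f : hom X Y),
    compc h (compc g f) = compc (compc h g) f
}.

Arguments hom {c} _ _.
Arguments idc {c} X.
Arguments compc {c X Y Z} _ _.

Notation "g \oc f" := (compc g f) (at level 40, left associativity).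

Definition Small := Type.

(* Small categories, with a single set of arrows.  Objects have to be compared
   for equality in double categories, and this presentation needs no transport.
   Composition is written in diagrammatic order. *)
Record cat := Cat {
  ob : Small;
  mor : Small;
  dom : mor -> ob;
  cod : mor -> ob;
  idm : ob -> mor;
  comp : forall f g : mor, cod f = dom g -> mor;
  dom_idm : forall x, dom (idm x) = x;
  cod_idm : forall x, cod (idm x) = x;
  dom_comp : forall f g (e : cod f = dom g), dom (@comp f g e) = dom f;
  cod_comp : forall f g (e : cod f = dom g), cod (@comp f g e) = cod g;
  comp_idl : forall f (e : cod (idm (dom f)) = dom f), @comp (idm (dom f)) f e = f;
  comp_idr : forall f (e : cod f = dom (idm (cod f))), @comp f (idm (cod f)) e = f;
  comp_assoc : forall f g h
    (e1 : cod f = dom g) (e2 : cod g = dom h)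
    (e3 : cod (@comp f g e1) = dom h) (e4 : cod f = dom (@comp g h e2)),
    @comp (@comp f g e1) h e3 = @comp f (@comp g h e2) e4
}.

Arguments dom {c} _.
Arguments cod {c} _.
Arguments idm {c} _.
Arguments comp {c} f g _.

Section Notions.
Variable C : category.

(* Diagrams of shape a small category [J]; [dmor f _ _] is the image of the
   arrow [f : x -> y] of [J]. *)
Record diagram (J : cat) := Diagram {
  dob : ob J -> obj C;
  dmor : forall (f : mor J) x y, dom f = x -> cod f = y -> hom (dob x) (dob y);
  dmor_id : forall x (e : dom (idm x) = x) (e' : cod (idm x) = x),
    @dmor (idm x) x x e e' = idc (dob x);
  dmor_comp : forall f g (e : cod f = dom g) x y z
    (fx : dom f = x) (fy : cod f = y) (gy : dom g = y) (gz : cod g = z)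
    (cx : dom (comp f g e) = x) (cz : cod (comp f g e) = z),
    @dmor (comp f g e) x z cx cz = @dmor g y z gy gz \oc @dmor f x y fx fy
}.

Definition is_cone J (D : diagram J) (L : obj C)
    (l : forall x, hom L (dob D x)) : Prop :=
  forall (f : mor J) x y (fx : dom f = x) (fy : cod f = y),
    dmor D f fx fy \oc l x = l y.

Definition is_cocone J (D : diagram J) (L : obj C)
    (l : forall x, hom (dob D x) L) : Prop :=
  forall (f : mor J) x y (fx : dom f = x) (fy : cod f = y),
    l y \oc dmor D f fx fy = l x.

Definition is_limit J (D : diagram J) (L : obj C)
    (l : forall x, hom L (dob D x)) : Prop :=
  is_cone D L l /\
  forall X (k : forall x, hom X (dob D x)), is_cone D X k ->
    exists! u : hom X L, forall x, l x \oc u = k x.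

Definition is_colimit J (D : diagram J) (L : obj C)
    (l : forall x, hom (dob D x) L) : Prop :=
  is_cocone D L l /\
  forall X (k : forall x, hom (dob D x) X), is_cocone D X k ->
    exists! u : hom L X, forall x, u \oc l x = k x.

Definition complete : Prop :=
  forall J (D : diagram J), exists L l, is_limit D L l.

Definition cocomplete : Prop :=
  forall J (D : diagram J), exists L l, is_colimit D L l.

(* The square with upper left corner [P] over the cospan [(f, g)]. *)
Definition is_pullback (P X Y Z : obj C) (p : hom P X) (q : hom P Y)
    (f : hom X Z) (g : hom Y Z) : Prop :=
  f \oc p = g \oc q /\
  forall W (h : hom W X) (k : hom W Y), f \oc h = g \oc k ->
    exists! u : hom W P, p \oc u = h /\ q \oc u = k.

Definition is_iso (X Y : obj C) (f : hom X Y) : Prop :=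
  exists g : hom Y X, g \oc f = idc X /\ f \oc g = idc Y.

Definition mor_class := forall X Y : obj C, hom X Y -> Prop.

Definition lifts (A B X Y : obj C) (i : hom A B) (p : hom X Y) : Prop :=
  forall (a : hom A X) (b : hom B Y), p \oc a = b \oc i ->
    exists h : hom B X, h \oc i = a /\ p \oc h = b.

Definition is_retract (X Y X' Y' : obj C) (f : hom X Y) (g : hom X' Y') : Prop :=
  exists (i : hom X X') (r : hom X' X) (j : hom Y Y') (q : hom Y' Y),
    r \oc i = idc X /\ q \oc j = idc Y /\
    g \oc i = j \oc f /\ f \oc r = q \oc g.

Arguments is_iso {X Y} f.
Arguments lifts {A B X Y} i p.
Arguments is_retract {X Y X' Y'} f g.

Definition retract_closed (M : mor_class) : Prop :=
  forall (X Y X' Y' : obj C) (f : hom X Y) (g : hom X' Y'),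
    is_retract f g -> M X' Y' g -> M X Y f.

Record model_structure (W Fib Cof : mor_class) : Prop := ModelStructure {
  ms_complete : complete;
  ms_cocomplete : cocomplete;
  ms_two_of_three : forall (X Y Z : obj C) (f : hom X Y) (g : hom Y Z),
    (W _ _ f -> W _ _ g -> W _ _ (g \oc f)) /\
    (W _ _ f -> W _ _ (g \oc f) -> W _ _ g) /\
    (W _ _ g -> W _ _ (g \oc f) -> W _ _ f);
  ms_retract_W : retract_closed W;
  ms_retract_Fib : retract_closed Fib;
  ms_retract_Cof : retract_closed Cof;
  ms_lift_cof_trivfib : forall (A B X Y : obj C) (i : hom A B) (p : hom X Y),
    Cof _ _ i -> Fib _ _ p -> W _ _ p -> lifts i p;
  ms_lift_trivcof_fib : forall (A B X Y : obj C) (i : hom A B) (p : hom X Y),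
    Cof _ _ i -> W _ _ i -> Fib _ _ p -> lifts i p;
  ms_factor_cof_trivfib : forall (X Y : obj C) (f : hom X Y),
    exists (Z : obj C) (i : hom X Z) (p : hom Z Y),
      f = p \oc i /\ Cof _ _ i /\ Fib _ _ p /\ W _ _ p;
  ms_factor_trivcof_fib : forall (X Y : obj C) (f : hom X Y),
    exists (Z : obj C) (i : hom X Z) (p : hom Z Y),
      f = p \oc i /\ Cof _ _ i /\ W _ _ i /\ Fib _ _ p
}.

(** * Grothendieck topologies, presented by a basis *)

Record basis := Basis {
  covers : forall (X : obj C) (I : Small) (U : I -> obj C),
    (forall i, hom (U i) X) -> Prop;
  covers_iso : forall (X Y : obj C) (f : hom Y X), is_iso f ->
    @covers X unit (fun _ => Y) (fun _ => f);
  covers_pullback : forall X (I : Small) (U : I -> obj C)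
    (f : forall i, hom (U i) X) Y (g : hom Y X) (P : I -> obj C)
    (p : forall i, hom (P i) Y) (q : forall i, hom (P i) (U i)),
    @covers X I U f -> (forall i, @is_pullback (P i) Y (U i) X (p i) (q i) g (f i)) ->
    @covers Y I P p;
  covers_trans : forall X (I : Small) (U : I -> obj C)
    (f : forall i, hom (U i) X) (J : I -> Small)
    (V : forall i, J i -> obj C) (g : forall i j, hom (V i j) (U i)),
    @covers X I U f -> (forall i, @covers (U i) (J i) (V i) (g i)) ->
    @covers X {i : I & J i} (fun k => V (projT1 k) (projT2 k))
      (fun k => f (projT1 k) \oc g (projT1 k) (projT2 k))
}.

(* [p] becomes an epimorphism after Yoneda and sheafification, expressed by
   local lifting along covering families of the basis. *)
Definition T_epi (T : basis) (E B : obj C) (p : hom E B) : Prop :=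
  forall X (g : hom X B),
    exists (I : Small) (U : I -> obj C)
           (f : forall i, hom (U i) X) (u : forall i, hom (U i) E),
      @covers T X I U f /\ forall i, p \oc u i = g \oc f i.

End Notions.

Arguments is_pullback {C P X Y Z} p q f g.
Arguments is_iso {C X Y} f.
Arguments lifts {C A B X Y} i p.
Arguments model_structure : clear implicits.

(** * The category of small categories *)

Record functor (A B : cat) := Functor {
  fob : ob A -> ob B;
  fmor : mor A -> mor B;
  fdom : forall f, dom (fmor f) = fob (dom f);
  fcod : forall f, cod (fmor f) = fob (cod f);
  fidm : forall x, fmor (idm x) = idm (fob x);
  fcomp : forall f g (e : cod f = dom g) (e' : cod (fmor f) = dom (fmor g)),
    fmor (comp f g e) = comp (fmor f) (fmor g) e'
}.

Lemma functor_eq A B (F G : functor A B) :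
  (forall x, fob F x = fob G x) -> (forall f, fmor F f = fmor G f) -> F = G.
Proof.
destruct F as [Fo Fm F1 F2 F3 F4], G as [Go Gm G1 G2 G3 G4]; simpl.
intros Ho Hm.
apply functional_extensionality in Ho; apply functional_extensionality in Hm.
subst Go Gm; f_equal; apply proof_irrelevance.
Qed.

Lemma comp_congr (A : cat) (f f' g g' : mor A) (e : cod f = dom g)
    (e' : cod f' = dom g') : f = f' -> g = g' -> comp f g e = comp f' g' e'.
Proof. intros -> ->; f_equal; apply proof_irrelevance. Qed.

Lemma sig_ext (A : Type) (P : A -> Prop) (x y : {a | P a}) :
  proj1_sig x = proj1_sig y -> x = y.
Proof.
destruct x as [x px], y as [y py]; simpl; intros ->; f_equal.
apply proof_irrelevance.
Qed.

Definition idF (A : cat) : functor A A.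
Proof.
refine {| fob := fun x => x; fmor := fun f => f |}; try reflexivity.
intros f g e e'; apply comp_congr; reflexivity.
Defined.

Definition compF A B C (G : functor B C) (F : functor A B) : functor A C.
Proof.
refine {| fob := fun x => fob G (fob F x); fmor := fun f => fmor G (fmor F f) |}.
- intros f; rewrite !fdom; reflexivity.
- intros f; rewrite !fcod; reflexivity.
- intros x; rewrite !fidm; reflexivity.
- intros f g e e'.
  assert (e1 : cod (fmor F f) = dom (fmor F g)) by (rewrite fcod, fdom, e; reflexivity).
  rewrite (fcomp F _ _ e e1); apply fcomp.
Defined.

Notation "G \of F" := (compF G F) (at level 40, left associativity).

Lemma compF_assoc A B C D (H : functor C D) (G : functor B C) (F : functor A B) :
  H \of (G \of F) = H \of G \of F.
Proof. apply functor_eq; reflexivity. Qed.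

Lemma compF_idl A B (F : functor A B) : idF B \of F = F.
Proof. apply functor_eq; reflexivity. Qed.

Lemma compF_idr A B (F : functor A B) : F \of idF A = F.
Proof. apply functor_eq; reflexivity. Qed.

Definition CAT : category.
Proof.
refine {| obj := cat; hom := functor; idc := idF; compc := compF |}; intros.
- apply compF_idl.
- apply compF_idr.
- apply compF_assoc.
Defined.

(* The subcategory of [A] on the objects satisfying [P] and the arrows
   satisfying [Q]. *)
Definition subcat (A : cat) (P : ob A -> Prop) (Q : mor A -> Prop)
  (Qdom : forall f, Q f -> P (dom f)) (Qcod : forall f, Q f -> P (cod f))
  (Qid : forall x, P x -> Q (idm x))
  (Qcomp : forall f g e, Q f -> Q g -> Q (comp f g e)) : cat.
Proof.
refine {|
  ob := {x : ob A | P x};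
  mor := {f : mor A | Q f};
  dom := fun f => exist _ (dom (proj1_sig f)) (Qdom _ (proj2_sig f));
  cod := fun f => exist _ (cod (proj1_sig f)) (Qcod _ (proj2_sig f));
  idm := fun x => exist _ (idm (proj1_sig x)) (Qid _ (proj2_sig x));
  comp := fun f g e =>
    exist _ (comp (proj1_sig f) (proj1_sig g) (f_equal (@proj1_sig _ _) e))
      (Qcomp _ _ _ (proj2_sig f) (proj2_sig g))
|}; intros; apply sig_ext; simpl.
- apply dom_idm.
- apply cod_idm.
- apply dom_comp.
- apply cod_comp.
- apply comp_idl.
- apply comp_idr.
- apply comp_assoc.
Defined.

Definition prod_cat (A B : cat) : cat.
Proof.
refine {|
  ob := (ob A * ob B)%type;
  mor := (mor A * mor B)%type;
  dom := fun f => (dom (fst f), dom (snd f));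
  cod := fun f => (cod (fst f), cod (snd f));
  idm := fun x => (idm (fst x), idm (snd x));
  comp := fun f g e =>
    (comp (fst f) (fst g) (f_equal fst e), comp (snd f) (snd g) (f_equal snd e))
|}; intros; repeat match goal with x : (_ * _)%type |- _ => destruct x end;
  simpl; f_equal.
- apply dom_idm.
- apply dom_idm.
- apply cod_idm.
- apply cod_idm.
- apply dom_comp.
- apply dom_comp.
- apply cod_comp.
- apply cod_comp.
- apply comp_idl.
- apply comp_idl.
- apply comp_idr.
- apply comp_idr.
- apply comp_assoc.
- apply comp_assoc.
Defined.

Definition prod_pair X A B (F : functor X A) (G : functor X B) :
  functor X (prod_cat A B).
Proof.
refine {| fob := fun x => (fob F x, fob G x) : ob (prod_cat A B);
          fmor := fun f => (fmor F f, fmor G f) : mor (prod_cat A B) |};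
  intros; simpl; f_equal; first [apply fdom | apply fcod | apply fidm | apply fcomp].
Defined.

Definition prod_map A B A' B' (F : functor A A') (G : functor B B') :
  functor (prod_cat A B) (prod_cat A' B').
Proof.
refine {| fob := fun x : ob (prod_cat A B) =>
            (fob F (fst x), fob G (snd x)) : ob (prod_cat A' B');
          fmor := fun f : mor (prod_cat A B) =>
            (fmor F (fst f), fmor G (snd f)) : mor (prod_cat A' B') |};
  intros; simpl; f_equal; first [apply fdom | apply fcod | apply fidm | apply fcomp].
Defined.

(* The pullback of [F] and [G], with its projections and pairings. *)
Definition pb_cat A B C (F : functor A C) (G : functor B C) : cat.
Proof.
refine (@subcat (prod_cat A B)
  (fun x => fob F (fst x) = fob G (snd x))
  (fun f => fmor F (fst f) = fmor G (snd f)) _ _ _ _); simpl.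
- intros f e; rewrite <- !fdom, e; reflexivity.
- intros f e; rewrite <- !fcod, e; reflexivity.
- intros x e; rewrite !fidm, e; reflexivity.
- intros [f f'] [g g'] e; simpl in *; intros e1 e2.
  pose proof (f_equal fst e) as ef; pose proof (f_equal snd e) as eg.
  simpl in ef, eg.
  assert (h1 : cod (fmor F f) = dom (fmor F g)) by (rewrite fcod, fdom, ef; reflexivity).
  assert (h2 : cod (fmor G f') = dom (fmor G g')) by (rewrite fcod, fdom, eg; reflexivity).
  rewrite (fcomp F _ _ _ h1), (fcomp G _ _ _ h2); apply comp_congr; assumption.
Defined.

Definition pb_fst A B C (F : functor A C) (G : functor B C) :
  functor (pb_cat F G) A.
Proof.
refine {| fob := fun x : ob (pb_cat F G) => fst (proj1_sig x);
          fmor := fun f : mor (pb_cat F G) => fst (proj1_sig f) |};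
  intros; simpl; try reflexivity.
apply comp_congr; reflexivity.
Defined.

Definition pb_snd A B C (F : functor A C) (G : functor B C) :
  functor (pb_cat F G) B.
Proof.
refine {| fob := fun x : ob (pb_cat F G) => snd (proj1_sig x);
          fmor := fun f : mor (pb_cat F G) => snd (proj1_sig f) |};
  intros; simpl; try reflexivity.
apply comp_congr; reflexivity.
Defined.

Arguments pb_fst {A B C} F G.
Arguments pb_snd {A B C} F G.

Definition pb_pair X A B C (F : functor A C) (G : functor B C)
  (H : functor X A) (K : functor X B) (e : F \of H = G \of K) :
  functor X (pb_cat F G).
Proof.
refine {|
  fob := fun x =>
    exist _ (fob H x, fob K x) (f_equal (fun L => fob L x) e) : ob (pb_cat F G);
  fmor := fun f =>
    exist _ (fmor H f, fmor K f) (f_equal (fun L => fmor L f) e) : mor (pb_cat F G)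
|}; intros; apply sig_ext; simpl; f_equal;
  first [apply fdom | apply fcod | apply fidm | apply fcomp].
Defined.

Arguments pb_pair {X A B C F G} H K e.

Lemma pb_pair_eq X A B C (F : functor A C) (G : functor B C)
    (H H' : functor X A) (K K' : functor X B)
    (e : F \of H = G \of K) (e' : F \of H' = G \of K') :
  H = H' -> K = K' -> pb_pair H K e = pb_pair H' K' e'.
Proof. intros -> ->; f_equal; apply proof_irrelevance. Qed.

Lemma pb_pair_comp X Y A B C (F : functor A C) (G : functor B C)
    (H : functor X A) (K : functor X B) (L : functor Y X)
    (e : F \of H = G \of K) (e' : F \of (H \of L) = G \of (K \of L)) :
  pb_pair H K e \of L = pb_pair (H \of L) (K \of L) e'.
Proof. apply functor_eq; intros x; apply sig_ext; reflexivity. Qed.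

Lemma pb_pair_id A B C (F : functor A C) (G : functor B C)
    (e : F \of pb_fst F G = G \of pb_snd F G) :
  pb_pair (pb_fst F G) (pb_snd F G) e = idF (pb_cat F G).
Proof. apply functor_eq; intros [[x y] ?]; apply sig_ext; reflexivity. Qed.

Lemma pb_fst_pair X A B C (F : functor A C) (G : functor B C)
    (H : functor X A) (K : functor X B) (e : F \of H = G \of K) :
  pb_fst F G \of pb_pair H K e = H.
Proof. apply functor_eq; reflexivity. Qed.

Lemma pb_snd_pair X A B C (F : functor A C) (G : functor B C)
    (H : functor X A) (K : functor X B) (e : F \of H = G \of K) :
  pb_snd F G \of pb_pair H K e = K.
Proof. apply functor_eq; reflexivity. Qed.

Lemma pb_commutes A B C (F : functor A C) (G : functor B C) :
  F \of pb_fst F G = G \of pb_snd F G.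
Proof. apply functor_eq; intros [x e]; exact e. Qed.

(** * The categorically surjective topology on [Cat] *)

Definition cat_surjective A B (F : functor A B) : Prop :=
  (forall y, exists x, fob F x = y) /\
  (forall (x x' : ob A) (g : mor B), dom g = fob F x -> cod g = fob F x' ->
    exists f, dom f = x /\ cod f = x' /\ fmor F f = g).

Definition tau'_covers (X : cat) (I : Small) (U : I -> cat)
    (f : forall i, functor (U i) X) : Prop :=
  (exists! _ : I, True) /\ forall i, cat_surjective (f i).


Lemma cat_surjective_iso X Y (f : functor Y X) :
  is_iso (C := CAT) f -> cat_surjective f.
Proof.
intros [g [gf fg]]; simpl in g, gf, fg.
assert (go : forall x, fob g (fob f x) = x)
  by (intros x; exact (f_equal (fun L => fob L x) gf)).
assert (fo : forall x, fob f (fob g x) = x)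
  by (intros x; exact (f_equal (fun L => fob L x) fg)).
assert (fm : forall x, fmor f (fmor g x) = x)
  by (intros x; exact (f_equal (fun L => fmor L x) fg)).
split.
- intros y; exists (fob g y); apply fo.
- intros x x' k kd kc; exists (fmor g k); rewrite fdom, fcod, kd, kc, !go.
  repeat split; apply fm.
Qed.

Lemma cat_surjective_comp X Y Z (f : functor X Y) (g : functor Y Z) :
  cat_surjective f -> cat_surjective g -> cat_surjective (g \of f).
Proof.
intros [fo fm] [go gm]; split.
- intros z; destruct (go z) as [y <-]; destruct (fo y) as [x <-].
  exists x; reflexivity.
- intros x x' k kd kc; simpl in kd, kc.
  destruct (gm _ _ k kd kc) as [l [ld [lc <-]]].
  destruct (fm _ _ l ld lc) as [m [md [mc <-]]].
  exists m; auto.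
Qed.

Lemma pb_fst_cat_surjective A B C (F : functor A C) (G : functor B C) :
  cat_surjective G -> cat_surjective (pb_fst F G).
Proof.
intros [Go Gm]; split.
- intros a; destruct (Go (fob F a)) as [b e].
  exists (exist _ (a, b) (eq_sym e)); reflexivity.
- intros [[a b] e] [[a' b'] e'] k kd kc; simpl in *.
  destruct (Gm b b' (fmor F k)) as [l [ld [lc le]]].
  + rewrite fdom, kd; exact e.
  + rewrite fcod, kc; exact e'.
  + exists (exist _ (k, l) (eq_sym le)); repeat split.
    * apply sig_ext; simpl; congruence.
    * apply sig_ext; simpl; congruence.
Qed.

Lemma cat_surjective_pullback P Y U X (p : functor P Y) (q : functor P U)
    (g : functor Y X) (f : functor U X) :
  is_pullback (C := CAT) p q g f -> cat_surjective f -> cat_surjective p.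
Proof.
intros [e univ] fs; simpl in e, univ.
destruct (univ _ _ _ (pb_commutes g f)) as [v [[pv qv] _]].
set (w := pb_pair p q e).
assert (pw : pb_fst g f \of w = p) by (apply functor_eq; reflexivity).
assert (qw : pb_snd g f \of w = q) by (apply functor_eq; reflexivity).
assert (vw : v \of w = idF P).
{ destruct (univ P p q e) as [u [_ uniq]].
  transitivity u; [symmetry|]; apply uniq; split.
  - transitivity (pb_fst g f \of w); [rewrite <- pv|]; auto.
    apply functor_eq; reflexivity.
  - transitivity (pb_snd g f \of w); [rewrite <- qv|]; auto.
    apply functor_eq; reflexivity.
  - apply functor_eq; reflexivity.
  - apply functor_eq; reflexivity. }
assert (wv : w \of v = idF _).
{ apply functor_eq; intros x; apply sig_ext; simpl.
  - transitivity (fst (proj1_sig x), snd (proj1_sig x));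
      [f_equal | destruct x as [[x1 x2] ?]; reflexivity].
    + exact (f_equal (fun L => fob L x) pv).
    + exact (f_equal (fun L => fob L x) qv).
  - transitivity (fst (proj1_sig x), snd (proj1_sig x));
      [f_equal | destruct x as [[x1 x2] ?]; reflexivity].
    + exact (f_equal (fun L => fmor L x) pv).
    + exact (f_equal (fun L => fmor L x) qv). }
rewrite <- pw; apply cat_surjective_comp.
- apply cat_surjective_iso; exists v; split; assumption.
- apply pb_fst_cat_surjective; exact fs.
Qed.

Definition tau' : basis CAT.
Proof.
refine (@Basis CAT tau'_covers _ _ _).
- intros X Y f fi; split.
  + exists tt; split; [exact I | intros []; reflexivity].
  + intros _; apply cat_surjective_iso; exact fi.
- intros X I U f Y g P p q [Is fs] pb; split; [exact Is|].
  intros i; exact (cat_surjective_pullback (pb i) (fs i)).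
- intros X I U f J V g [[i0 [_ Iu]] fs] gs; split.
  + destruct (gs i0) as [[j0 [_ Ju]] _].
    exists (existT _ i0 j0); split; [exact Logic.I|].
    intros [i j] _; destruct (Iu i Logic.I).
    f_equal; apply Ju; exact Logic.I.
  + intros [i j]; apply cat_surjective_comp; [apply (gs i) | apply fs].
Defined.

(** * Double categories *)

(* Internal categories in [Cat]: [d0] has the objects and vertical morphisms,
   [d1] the horizontal morphisms and squares, and [hcomp] is horizontal
   composition in diagrammatic order.  The equations quantified over in [e],
   [e1], ... are the ones needed to form the pairings; they all follow from the
   equations on [src] and [tgt]. *)
Record dblcat := DblCat {
  d0 : cat;
  d1 : cat;
  src : functor d1 d0;
  tgt : functor d1 d0;
  hunit : functor d0 d1;
  hcomp : functor (pb_cat tgt src) d1;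
  src_hunit : src \of hunit = idF d0;
  tgt_hunit : tgt \of hunit = idF d0;
  src_hcomp : src \of hcomp = src \of pb_fst tgt src;
  tgt_hcomp : tgt \of hcomp = tgt \of pb_snd tgt src;
  hcomp_idl : forall e : tgt \of (hunit \of src) = src \of idF d1,
    hcomp \of pb_pair (hunit \of src) (idF d1) e = idF d1;
  hcomp_idr : forall e : tgt \of idF d1 = src \of (hunit \of tgt),
    hcomp \of pb_pair (idF d1) (hunit \of tgt) e = idF d1;
  hcomp_assoc :
    let triples := pb_cat (tgt \of pb_snd tgt src) src in
    let fg : functor triples _ := pb_fst _ _ in
    let f : functor triples d1 := pb_fst tgt src \of fg in
    let g : functor triples d1 := pb_snd tgt src \of fg in
    let h : functor triples d1 := pb_snd _ _ in
    forall (e1 : tgt \of (hcomp \of fg) = src \of h)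
           (e2 : tgt \of g = src \of h)
           (e3 : tgt \of f = src \of (hcomp \of pb_pair g h e2)),
    hcomp \of pb_pair (hcomp \of fg) h e1 =
    hcomp \of pb_pair f (hcomp \of pb_pair g h e2) e3
}.

Arguments src {d}.
Arguments tgt {d}.
Arguments hunit {d}.
Arguments hcomp {d}.

Record dblfunctor (A B : dblcat) := DblFunctor {
  F0 : functor (d0 A) (d0 B);
  F1 : functor (d1 A) (d1 B);
  src_F : src \of F1 = F0 \of src;
  tgt_F : tgt \of F1 = F0 \of tgt;
  hunit_F : F1 \of hunit = hunit \of F0;
  hcomp_F : forall e : tgt \of (F1 \of pb_fst tgt src) =
                       src \of (F1 \of pb_snd tgt src),
    F1 \of hcomp =
    hcomp \of pb_pair (F1 \of pb_fst tgt src) (F1 \of pb_snd tgt src) e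
}.

Lemma dblfunctor_eq A B (F G : dblfunctor A B) : F0 F = F0 G -> F1 F = F1 G -> F = G.
Proof.
destruct F, G; simpl; intros -> ->; f_equal; apply proof_irrelevance.
Qed.

Definition id_dbl (A : dblcat) : dblfunctor A A.
Proof.
refine {| F0 := idF (d0 A); F1 := idF (d1 A) |};
  try (rewrite compF_idl, compF_idr; reflexivity).
intros e; rewrite compF_idl.
rewrite (@pb_pair_eq _ _ _ _ _ _ _ _ _ _ e (pb_commutes tgt src) (compF_idl _) (compF_idl _)).
rewrite pb_pair_id, compF_idr; reflexivity.
Defined.

Lemma F_composable A B (F : dblfunctor A B) :
  tgt \of (F1 F \of pb_fst tgt src) = src \of (F1 F \of pb_snd tgt src).
Proof.
rewrite !compF_assoc, tgt_F, src_F, <- !compF_assoc, pb_commutes; reflexivity.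
Qed.

Definition comp_dbl A B C (G : dblfunctor B C) (F : dblfunctor A B) :
  dblfunctor A C.
Proof.
refine {| F0 := F0 G \of F0 F; F1 := F1 G \of F1 F |}.
- rewrite compF_assoc, src_F, <- !compF_assoc, src_F; reflexivity.
- rewrite compF_assoc, tgt_F, <- !compF_assoc, tgt_F; reflexivity.
- rewrite <- compF_assoc, hunit_F, !compF_assoc, hunit_F; reflexivity.
- intros e.
  rewrite <- compF_assoc, (hcomp_F F (F_composable F)), compF_assoc.
  rewrite (hcomp_F G (F_composable G)), <- compF_assoc; f_equal.
  assert (e' : tgt \of (F1 G \of pb_fst tgt src \of
                         pb_pair _ _ (F_composable F)) =
               src \of (F1 G \of pb_snd tgt src \of
                         pb_pair _ _ (F_composable F)))
    by exact (eq_trans (compF_assoc _ _ _)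
         (eq_trans (f_equal (fun L => L \of _) (F_composable G))
            (eq_sym (compF_assoc _ _ _)))).
  rewrite (pb_pair_comp _ e'); apply pb_pair_eq.
  + rewrite <- !compF_assoc, pb_fst_pair; reflexivity.
  + rewrite <- !compF_assoc, pb_snd_pair; reflexivity.
Defined.

Definition DBLCAT : category.
Proof.
refine {| obj := dblcat; hom := dblfunctor; idc := id_dbl; compc := comp_dbl |};
  intros; apply dblfunctor_eq; simpl;
  first [apply compF_idl | apply compF_idr | apply compF_assoc].
Defined.

Lemma fob_eq A B (F G : functor A B) : F = G -> forall x, fob F x = fob G x.
Proof. intros ->; reflexivity. Qed.

Lemma fmor_eq A B (F G : functor A B) : F = G -> forall f, fmor F f = fmor G f.
Proof. intros ->; reflexivity. Qed.

(* Objects and horizontal morphisms, under horizontal composition. *)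
Definition hcat_ob (D : dblcat) : cat.
Proof.
refine {|
  ob := ob (d0 D); mor := ob (d1 D); dom := fob src; cod := fob tgt;
  idm := fob hunit;
  comp := fun f g e => fob hcomp (exist _ (f, g) e : ob (pb_cat tgt src)) |}.
- exact (fob_eq (src_hunit D)).
- exact (fob_eq (tgt_hunit D)).
- intros f g e; exact (fob_eq (src_hcomp D) _).
- intros f g e; exact (fob_eq (tgt_hcomp D) _).
- intros f e.
  assert (e' : tgt \of (hunit \of src) = src \of idF (d1 D))
    by (rewrite compF_assoc, tgt_hunit, compF_idl, compF_idr; reflexivity).
  etransitivity; [|exact (fob_eq (hcomp_idl D e') f)].
  simpl; f_equal; apply sig_ext; reflexivity.
- intros f e.
  assert (e' : tgt \of idF (d1 D) = src \of (hunit \of tgt))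
    by (rewrite compF_assoc, src_hunit, compF_idl, compF_idr; reflexivity).
  etransitivity; [|exact (fob_eq (hcomp_idr D e') f)].
  simpl; f_equal; apply sig_ext; reflexivity.
- intros f g h e1 e2 e3 e4.
  set (fg := pb_fst (tgt \of pb_snd tgt src) (@src D)).
  set (h' := pb_snd (tgt \of pb_snd tgt src) (@src D)).
  assert (a1 : tgt \of (hcomp \of fg) = src \of h')
    by (rewrite compF_assoc, tgt_hcomp; apply pb_commutes).
  assert (a2 : tgt \of (pb_snd tgt src \of fg) = src \of h')
    by (rewrite compF_assoc; apply pb_commutes).
  assert (a3 : tgt \of (pb_fst tgt src \of fg) =
               src \of (hcomp \of pb_pair (pb_snd tgt src \of fg) h' a2))
    by (rewrite (compF_assoc src), src_hcomp, <- (compF_assoc src), pb_fst_pair,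
          (compF_assoc tgt), (compF_assoc src), pb_commutes; reflexivity).
  pose (T := exist _ (exist _ (f, g) e1 : ob (pb_cat tgt src), h) e2
          : ob (pb_cat (tgt \of pb_snd tgt src) src)).
  etransitivity; [|etransitivity; [exact (fob_eq (hcomp_assoc D a1 a3) T)|]];
    simpl; f_equal; apply sig_ext; [reflexivity|].
  simpl; f_equal; f_equal; apply sig_ext; reflexivity.
Defined.

(* Vertical morphisms and squares, under horizontal composition. *)
Definition hcat_sq (D : dblcat) : cat.
Proof.
refine {|
  ob := mor (d0 D); mor := mor (d1 D); dom := fmor src; cod := fmor tgt;
  idm := fmor hunit;
  comp := fun f g e => fmor hcomp (exist _ (f, g) e : mor (pb_cat tgt src)) |}.
- exact (fmor_eq (src_hunit D)).
- exact (fmor_eq (tgt_hunit D)).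
- intros f g e; exact (fmor_eq (src_hcomp D) _).
- intros f g e; exact (fmor_eq (tgt_hcomp D) _).
- intros f e.
  assert (e' : tgt \of (hunit \of src) = src \of idF (d1 D))
    by (rewrite compF_assoc, tgt_hunit, compF_idl, compF_idr; reflexivity).
  etransitivity; [|exact (fmor_eq (hcomp_idl D e') f)].
  simpl; f_equal; apply sig_ext; reflexivity.
- intros f e.
  assert (e' : tgt \of idF (d1 D) = src \of (hunit \of tgt))
    by (rewrite compF_assoc, src_hunit, compF_idl, compF_idr; reflexivity).
  etransitivity; [|exact (fmor_eq (hcomp_idr D e') f)].
  simpl; f_equal; apply sig_ext; reflexivity.
- intros f g h e1 e2 e3 e4.
  set (fg := pb_fst (tgt \of pb_snd tgt src) (@src D)).
  set (h' := pb_snd (tgt \of pb_snd tgt src) (@src D)).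
  assert (a1 : tgt \of (hcomp \of fg) = src \of h')
    by (rewrite compF_assoc, tgt_hcomp; apply pb_commutes).
  assert (a2 : tgt \of (pb_snd tgt src \of fg) = src \of h')
    by (rewrite compF_assoc; apply pb_commutes).
  assert (a3 : tgt \of (pb_fst tgt src \of fg) =
               src \of (hcomp \of pb_pair (pb_snd tgt src \of fg) h' a2))
    by (rewrite (compF_assoc src), src_hcomp, <- (compF_assoc src), pb_fst_pair,
          (compF_assoc tgt), (compF_assoc src), pb_commutes; reflexivity).
  pose (T := exist _ (exist _ (f, g) e1 : mor (pb_cat tgt src), h) e2
          : mor (pb_cat (tgt \of pb_snd tgt src) src)).
  etransitivity; [|etransitivity; [exact (fmor_eq (hcomp_assoc D a1 a3) T)|]];
    simpl; f_equal; apply sig_ext; [reflexivity|].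
  simpl; f_equal; f_equal; apply sig_ext; reflexivity.
Defined.

Definition inverse (A : cat) (f g : mor A) : Prop :=
  exists (e : cod f = dom g) (e' : cod g = dom f),
    comp f g e = idm (dom f) /\ comp g f e' = idm (dom g).

Definition invertible (A : cat) (f : mor A) : Prop := exists g, inverse A f g.

Lemma inverse_unique (A : cat) (f g h : mor A) :
  inverse A f g -> inverse A f h -> g = h.
Proof.
assert (idl : forall (i k : mor A) (e : cod i = dom k), i = idm (dom k) -> comp i k e = k)
  by (intros i k e ->; apply comp_idl).
assert (idr : forall (i k : mor A) (e : cod k = dom i), i = idm (cod k) -> comp k i e = k)
  by (intros i k e ->; apply comp_idr).
intros [e1 [e1' [fg gf]]] [e2 [e2' [fh hf]]].
assert (a : cod (comp g f e1') = dom h) by (rewrite cod_comp; exact e2).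
assert (b : cod g = dom (comp f h e2)) by (rewrite dom_comp; exact e1').
transitivity (comp g (comp f h e2) b).
- symmetry; apply idr; rewrite fh, e1'; reflexivity.
- rewrite <- (comp_assoc A g f h e1' e2 a b); apply idl.
  rewrite gf, <- e1, e2; reflexivity.
Qed.

Lemma inverse_fmor A B (F : functor A B) f g :
  inverse A f g -> inverse B (fmor F f) (fmor F g).
Proof.
intros [e [e' [fg gf]]].
assert (e1 : cod (fmor F f) = dom (fmor F g)) by (rewrite fcod, fdom, e; reflexivity).
assert (e1' : cod (fmor F g) = dom (fmor F f)) by (rewrite fcod, fdom, e'; reflexivity).
exists e1, e1'.
rewrite <- (fcomp F _ _ e e1), <- (fcomp F _ _ e' e1'), fg, gf, !fdom, !fidm.
split; reflexivity.
Qed.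

Lemma invertible_fmor A B (F : functor A B) f :
  invertible A f -> invertible B (fmor F f).
Proof. intros [g i]; exists (fmor F g); apply inverse_fmor; exact i. Qed.

(* Vertical source, target and identity are functorial for horizontal
   composition. *)
Definition hdom (D : dblcat) : functor (hcat_sq D) (hcat_ob D).
Proof.
refine {| fob := fun x : ob (hcat_sq D) => dom (c := d0 D) x : ob (hcat_ob D);
          fmor := fun f : mor (hcat_sq D) => dom (c := d1 D) f : mor (hcat_ob D) |}.
- intros f; symmetry; exact (fdom src f).
- intros f; symmetry; exact (fdom tgt f).
- intros x; exact (fdom hunit x).
- intros f g e e'; etransitivity; [exact (fdom hcomp _)|].
  simpl; f_equal; apply sig_ext; reflexivity.
Defined.

Definition hcod (D : dblcat) : functor (hcat_sq D) (hcat_ob D).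
Proof.
refine {| fob := fun x : ob (hcat_sq D) => cod (c := d0 D) x : ob (hcat_ob D);
          fmor := fun f : mor (hcat_sq D) => cod (c := d1 D) f : mor (hcat_ob D) |}.
- intros f; symmetry; exact (fcod src f).
- intros f; symmetry; exact (fcod tgt f).
- intros x; exact (fcod hunit x).
- intros f g e e'; etransitivity; [exact (fcod hcomp _)|].
  simpl; f_equal; apply sig_ext; reflexivity.
Defined.

Definition hidm (D : dblcat) : functor (hcat_ob D) (hcat_sq D).
Proof.
refine {| fob := fun x : ob (hcat_ob D) => idm (c := d0 D) x : ob (hcat_sq D);
          fmor := fun f : mor (hcat_ob D) => idm (c := d1 D) f : mor (hcat_sq D) |}.
- intros f; exact (fidm src f).
- intros f; exact (fidm tgt f).
- intros x; symmetry; exact (fidm hunit x).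
- intros f g e e'; etransitivity; [symmetry; exact (fidm hcomp _)|].
  simpl; f_equal; apply sig_ext; reflexivity.
Defined.

Lemma hcomp_comp (D : dblcat) (a b c d : mor (d1 D)) (ab : fmor tgt a = fmor src b)
    (cd : fmor tgt c = fmor src d) (ac : cod a = dom c) (bd : cod b = dom d)
    (e : fmor tgt (comp a c ac) = fmor src (comp b d bd))
    (e' : cod (fmor hcomp (exist _ (a, b) ab : mor (pb_cat tgt src))) =
          dom (fmor hcomp (exist _ (c, d) cd : mor (pb_cat tgt src)))) :
  fmor hcomp (exist _ (comp a c ac, comp b d bd) e : mor (pb_cat tgt src)) =
  comp (fmor hcomp (exist _ (a, b) ab : mor (pb_cat tgt src)))
       (fmor hcomp (exist _ (c, d) cd : mor (pb_cat tgt src))) e'.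
Proof.
assert (e2 : cod (exist _ (a, b) ab : mor (pb_cat tgt src)) =
             dom (exist _ (c, d) cd : mor (pb_cat tgt src)))
  by (apply sig_ext; simpl; congruence).
etransitivity; [|exact (fcomp hcomp _ _ e2 e')]; f_equal; apply sig_ext; simpl.
f_equal; apply comp_congr; reflexivity.
Qed.

Lemma invertible_vcomp (D : dblcat) (f g : mor (d1 D)) (e : cod f = dom g) :
  invertible (hcat_sq D) f -> invertible (hcat_sq D) g ->
  invertible (hcat_sq D) (comp f g e).
Proof.
intros [f' If] [g' Ig].
assert (e' : cod (c := d1 D) f' = dom (c := d1 D) g').
{ apply (inverse_unique (A := hcat_ob D) (f := cod (c := d1 D) f)).
  - exact (inverse_fmor (hcod D) If).
  - rewrite e; exact (inverse_fmor (hdom D) Ig). }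
destruct If as [e1 [e1' [ff' f'f]]], Ig as [e2 [e2' [gg' g'g]]].
change (fmor tgt f = fmor src f') in e1; change (fmor tgt f' = fmor src f) in e1'.
change (fmor tgt g = fmor src g') in e2; change (fmor tgt g' = fmor src g) in e2'.
change (fmor hcomp (exist _ (f, f') e1 : mor (pb_cat tgt src)) =
        fmor hunit (fmor src f)) in ff'.
change (fmor hcomp (exist _ (f', f) e1' : mor (pb_cat tgt src)) =
        fmor hunit (fmor src f')) in f'f.
change (fmor hcomp (exist _ (g, g') e2 : mor (pb_cat tgt src)) =
        fmor hunit (fmor src g)) in gg'.
change (fmor hcomp (exist _ (g', g) e2' : mor (pb_cat tgt src)) =
        fmor hunit (fmor src g')) in g'g.
exists (comp (c := d1 D) f' g' e').
assert (k : fmor tgt (comp (c := d1 D) f g e) = fmor src (comp (c := d1 D) f' g' e')).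
{ assert (k1 : cod (fmor tgt f) = dom (fmor tgt g)) by (rewrite fcod, fdom, e; reflexivity).
  assert (k2 : cod (fmor src f') = dom (fmor src g')) by (rewrite fcod, fdom, e'; reflexivity).
  rewrite (fcomp tgt _ _ e k1), (fcomp src _ _ e' k2); apply comp_congr; assumption. }
assert (k' : fmor tgt (comp (c := d1 D) f' g' e') = fmor src (comp (c := d1 D) f g e)).
{ assert (k1 : cod (fmor tgt f') = dom (fmor tgt g')) by (rewrite fcod, fdom, e'; reflexivity).
  assert (k2 : cod (fmor src f) = dom (fmor src g)) by (rewrite fcod, fdom, e; reflexivity).
  rewrite (fcomp tgt _ _ e' k1), (fcomp src _ _ e k2); apply comp_congr; assumption. }
exists k, k'; split.
- assert (l : cod (fmor hcomp (exist _ (f, f') e1 : mor (pb_cat tgt src))) =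
              dom (fmor hcomp (exist _ (g, g') e2 : mor (pb_cat tgt src)))).
  { rewrite ff', gg', !fcod, !fdom, e; reflexivity. }
  etransitivity; [exact (@hcomp_comp D _ _ _ _ e1 e2 e e' k l)|].
  change (comp (fmor hcomp (exist _ (f, f') e1 : mor (pb_cat tgt src)))
    (fmor hcomp (exist _ (g, g') e2 : mor (pb_cat tgt src))) l =
    fmor hunit (fmor src (comp (c := d1 D) f g e))).
  assert (m : cod (fmor src f) = dom (fmor src g)) by (rewrite fcod, fdom, e; reflexivity).
  assert (n : cod (fmor hunit (fmor src f)) = dom (fmor hunit (fmor src g)))
    by (rewrite fcod, fdom, m; reflexivity).
  rewrite (fcomp src _ _ e m), (fcomp hunit _ _ m n).
  apply comp_congr; assumption.
- assert (l : cod (fmor hcomp (exist _ (f', f) e1' : mor (pb_cat tgt src))) =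
              dom (fmor hcomp (exist _ (g', g) e2' : mor (pb_cat tgt src)))).
  { rewrite f'f, g'g, !fcod, !fdom, e'; reflexivity. }
  etransitivity; [exact (@hcomp_comp D _ _ _ _ e1' e2' e' e k' l)|].
  change (comp (fmor hcomp (exist _ (f', f) e1' : mor (pb_cat tgt src)))
    (fmor hcomp (exist _ (g', g) e2' : mor (pb_cat tgt src))) l =
    fmor hunit (fmor src (comp (c := d1 D) f' g' e'))).
  assert (m : cod (fmor src f') = dom (fmor src g')) by (rewrite fcod, fdom, e'; reflexivity).
  assert (n : cod (fmor hunit (fmor src f')) = dom (fmor hunit (fmor src g')))
    by (rewrite fcod, fdom, m; reflexivity).
  rewrite (fcomp src _ _ e' m), (fcomp hunit _ _ m n).
  apply comp_congr; assumption.
Qed.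

(* [iso(D)_1] as a subcategory of [d1 D]. *)
Definition iso1 (D : dblcat) : cat.
Proof.
refine (@subcat (d1 D) (invertible (hcat_ob D)) (invertible (hcat_sq D)) _ _ _ _).
- intros f; exact (@invertible_fmor _ _ (hdom D) f).
- intros f; exact (@invertible_fmor _ _ (hcod D) f).
- intros x; exact (@invertible_fmor _ _ (hidm D) x).
- intros f g e; apply invertible_vcomp.
Defined.

Definition iso1_incl (D : dblcat) : functor (iso1 D) (d1 D).
Proof.
refine {| fob := fun x : ob (iso1 D) => proj1_sig x;
          fmor := fun f : mor (iso1 D) => proj1_sig f |}; try reflexivity.
intros f g e e'; apply comp_congr; reflexivity.
Defined.

Definition iso_src (D : dblcat) : functor (iso1 D) (d0 D) := src \of iso1_incl D.
Definition iso_tgt (D : dblcat) : functor (iso1 D) (d0 D) := tgt \of iso1_incl D.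

Definition hcat_ob_map A B (F : dblfunctor A B) : functor (hcat_ob A) (hcat_ob B).
Proof.
refine {| fob := fob (F0 F) : ob (hcat_ob A) -> ob (hcat_ob B);
          fmor := fob (F1 F) : mor (hcat_ob A) -> mor (hcat_ob B) |}.
- exact (fob_eq (src_F F)).
- exact (fob_eq (tgt_F F)).
- exact (fob_eq (hunit_F F)).
- intros f g e e'; etransitivity; [exact (fob_eq (hcomp_F F (F_composable F)) _)|].
  simpl; f_equal; apply sig_ext; reflexivity.
Defined.

Definition hcat_sq_map A B (F : dblfunctor A B) : functor (hcat_sq A) (hcat_sq B).
Proof.
refine {| fob := fmor (F0 F) : ob (hcat_sq A) -> ob (hcat_sq B);
          fmor := fmor (F1 F) : mor (hcat_sq A) -> mor (hcat_sq B) |}.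
- exact (fmor_eq (src_F F)).
- exact (fmor_eq (tgt_F F)).
- exact (fmor_eq (hunit_F F)).
- intros f g e e'; etransitivity; [exact (fmor_eq (hcomp_F F (F_composable F)) _)|].
  simpl; f_equal; apply sig_ext; reflexivity.
Defined.

Definition iso1_map A B (F : dblfunctor A B) : functor (iso1 A) (iso1 B).
Proof.
refine {|
  fob := fun x : ob (iso1 A) =>
    exist _ (fob (F1 F) (proj1_sig x))
      (@invertible_fmor _ _ (hcat_ob_map F) _ (proj2_sig x)) : ob (iso1 B);
  fmor := fun f : mor (iso1 A) =>
    exist _ (fmor (F1 F) (proj1_sig f))
      (@invertible_fmor _ _ (hcat_sq_map F) _ (proj2_sig f)) : mor (iso1 B)
|}; intros; apply sig_ext; simpl;
  first [apply fdom | apply fcod | apply fidm | apply fcomp].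
Defined.

(** * Equivalences, fibrations and cofibrations relative to a topology *)

(* [(P_F)_0]: pairs of an object [a] of [A] and an isomorphism [b -> F a]. *)
Definition path0 A B (F : dblfunctor A B) : cat := pb_cat (F0 F) (iso_tgt B).

Lemma r0_commutes A B (F : dblfunctor A B) :
  F0 F \of iso_tgt A = iso_tgt B \of iso1_map F.
Proof.
apply functor_eq; intros x; simpl; symmetry.
- exact (fob_eq (tgt_F F) _).
- exact (fmor_eq (tgt_F F) _).
Qed.

(* [(r_F)_0], induced by [t : iso(A)_1 -> A_0] and [iso(F)_1]. *)
Definition r0 A B (F : dblfunctor A B) : functor (iso1 A) (path0 F) :=
  pb_pair (iso_tgt A) (iso1_map F) (r0_commutes F).

Definition ess_surjective (T : basis CAT) A B (F : dblfunctor A B) : Prop :=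
  @T_epi CAT T (path0 F) (d0 B) (iso_src B \of pb_snd (F0 F) (iso_tgt B)).

Definition fully_faithful A B (F : dblfunctor A B) : Prop :=
  @is_pullback CAT (d1 A) (prod_cat (d0 A) (d0 A)) (d1 B) (prod_cat (d0 B) (d0 B))
    (prod_pair src tgt) (F1 F) (prod_map (F0 F) (F0 F)) (prod_pair src tgt).

Definition we (T : basis CAT) : mor_class DBLCAT :=
  fun A B F => fully_faithful F /\ ess_surjective T F.

Definition fib (T : basis CAT) : mor_class DBLCAT :=
  fun A B F => @T_epi CAT T (iso1 A) (path0 F) (r0 F).

Definition cof (T : basis CAT) : mor_class DBLCAT :=
  fun A B F => forall (X Y : dblcat) (G : dblfunctor X Y),
    @fib T X Y G -> @we T X Y G -> @lifts DBLCAT A B X Y F G.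

(* Main.v *)
From Stdlib Require Import ClassicalEpsilon ProofIrrelevance FunctionalExtensionality List.
Require Import Defs.

(* A functor is tau'-epi iff its points over every projective category can be
   lifted, where a category is projective if it lifts against all categorically
   surjective functors; the free category on the underlying graph of [X] is
   projective and covers [X].  A double functor [F] induces for each category
   [P] an ordinary functor between the categories of [P]-points, and [F] is a
   tau'-equivalence (tau'-fibration) iff these are equivalences (isofibrations)
   for all projective [P], with full faithfulness for arbitrary [P].  Hence
   two-out-of-three and closure under retracts are inherited from ordinary
   categories.

   Both factorizations of [F : X -> Y] adjoin to the objects of [X] a
   projective category [P] as a coproduct summand: one covering [Y_0], giving
   the double category with homs from [Y], or one covering [(P_F)_0], giving
   homs from [X] and a projection to [Y] twisted by the universal horizontal
   isomorphism.  In the second case the inclusion of [X] has a retraction up to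
   an isomorphism that is the identity on [X], so it lifts against fibrations by
   lifting that isomorphism on [P] and conjugating; the retract argument then
   treats all trivial cofibrations.

   Limits and colimits are realized inside the (large) product of the diagram,
   respectively of all cocones, as the small family of compatible elements,
   respectively of values of well-defined terms in the generators. *)

Set Implicit Arguments.
Unset Strict Implicit.

(* Composition as a total operation, with junk value [f] on non-composable pairs. *)
Definition tc (A : cat) (f g : mor A) : mor A :=
  match excluded_middle_informative (cod f = dom g) with
  | left e => comp f g e
  | right _ => f
  end.

Lemma tcE (A : cat) (f g : mor A) (e : cod f = dom g) : comp f g e = tc f g.
Proof.
unfold tc; destruct excluded_middle_informative as [e'|n]; [|contradiction].
apply comp_congr; reflexivity.
Qed.

Arguments tcE [A] f g e.

Lemma dom_tc (A : cat) (f g : mor A) : cod f = dom g -> dom (tc f g) = dom f.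
Proof. intros e; rewrite <- (tcE _ _ e); apply dom_comp. Qed.

Lemma cod_tc (A : cat) (f g : mor A) : cod f = dom g -> cod (tc f g) = cod g.
Proof. intros e; rewrite <- (tcE _ _ e); apply cod_comp. Qed.

Lemma tc_idl (A : cat) (f : mor A) x : x = dom f -> tc (idm x) f = f.
Proof.
intros ->; assert (e : cod (idm (dom f)) = dom f) by apply cod_idm.
rewrite <- (tcE _ _ e); apply comp_idl.
Qed.

Lemma tc_idr (A : cat) (f : mor A) x : x = cod f -> tc f (idm x) = f.
Proof.
intros ->; assert (e : cod f = dom (idm (cod f))) by (symmetry; apply dom_idm).
rewrite <- (tcE _ _ e); apply comp_idr.
Qed.

Lemma tcA (A : cat) (f g h : mor A) :
  cod f = dom g -> cod g = dom h -> tc (tc f g) h = tc f (tc g h).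
Proof.
intros e1 e2.
assert (e3 : cod (comp f g e1) = dom h) by (rewrite cod_comp; exact e2).
assert (e4 : cod f = dom (comp g h e2)) by (rewrite dom_comp; exact e1).
rewrite <- (tcE _ _ e1), <- (tcE _ _ e2), <- (tcE _ _ e3), <- (tcE _ _ e4).
apply comp_assoc.
Qed.

Lemma fmor_tc A B (F : functor A B) f g :
  cod f = dom g -> fmor F (tc f g) = tc (fmor F f) (fmor F g).
Proof.
intros e.
assert (e' : cod (fmor F f) = dom (fmor F g)) by (rewrite fcod, fdom, e; reflexivity).
rewrite <- (tcE _ _ e), <- (tcE _ _ e'); apply fcomp.
Qed.

Arguments fmor_tc [A B] F f g _.

(** * Double categories as four-sorted partial algebras *)

(* Objects, vertical morphisms, horizontal morphisms, squares. *)
Inductive sort : Set := SO | SV | SH | SS.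

(** The letters [d], [c], [i] stand for vertical domain, codomain and identity, and [s], [t], [u]
    for horizontal source, target and unit. *)
Inductive uop : sort -> sort -> Set :=
| dV : uop SV SO | cV : uop SV SO | iV : uop SO SV
| dS : uop SS SH | cS : uop SS SH | iS : uop SH SS
| sO : uop SH SO | tO : uop SH SO | uO : uop SO SH
| sV : uop SS SV | tV : uop SS SV | uV : uop SV SS.

(** Vertical ([m]) and horizontal ([h]) compositions. The second index is the sort of the endpoints
    that must agree, so with [lft], [rgt] and [nul] each operation describes one of the four
    categories inside a double category. *)
Inductive bop : sort -> sort -> Set :=
| mV : bop SV SO | mS : bop SS SH | hO : bop SH SO | hV : bop SS SV.

Definition lft s t (b : bop s t) : uop s t :=
  match b with mV => dV | mS => dS | hO => sO | hV => sV end.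
Definition rgt s t (b : bop s t) : uop s t :=
  match b with mV => cV | mS => cS | hO => tO | hV => tV end.
Definition nul s t (b : bop s t) : uop t s :=
  match b with mV => iV | mS => iS | hO => uO | hV => uV end.

(** Operations are total so that algebras can be handled sort by sort; the laws below constrain
    [bin] only where [def] holds. *)
Record alg := Alg {
  car : sort -> Small;
  un : forall s t, uop s t -> car s -> car t;
  bin : forall s t, bop s t -> car s -> car s -> car s
}.

Arguments un a [s t] _ _.
Arguments bin a [s t] _ _ _.

Definition def (A : alg) s t (b : bop s t) (x y : car A s) : Prop :=
  un A (rgt b) x = un A (lft b) y.

Arguments def A [s t] b x y.

(** The first seven fields make each binary operation a category, treating all four uniformly. The
    blocks [sV], [tV], [uV] make source, target and unit functorial, and the [hV] fields with
    [interchange] do so for horizontal composition. *)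
Record lawful (A : alg) : Prop := {
  lft_nul : forall s t (b : bop s t) x, un A (lft b) (un A (nul b) x) = x;
  rgt_nul : forall s t (b : bop s t) x, un A (rgt b) (un A (nul b) x) = x;
  lft_bin : forall s t (b : bop s t) x y, def A b x y ->
    un A (lft b) (bin A b x y) = un A (lft b) x;
  rgt_bin : forall s t (b : bop s t) x y, def A b x y ->
    un A (rgt b) (bin A b x y) = un A (rgt b) y;
  bin_nul_l : forall s t (b : bop s t) x,
    bin A b (un A (nul b) (un A (lft b) x)) x = x;
  bin_nul_r : forall s t (b : bop s t) x,
    bin A b x (un A (nul b) (un A (rgt b) x)) = x;
  bin_assoc : forall s t (b : bop s t) x y z, def A b x y -> def A b y z ->
    bin A b (bin A b x y) z = bin A b x (bin A b y z);
  sV_dS : forall x, un A dV (un A sV x) = un A sO (un A dS x);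
  sV_cS : forall x, un A cV (un A sV x) = un A sO (un A cS x);
  sV_iS : forall x, un A sV (un A iS x) = un A iV (un A sO x);
  sV_mS : forall x y, def A mS x y ->
    un A sV (bin A mS x y) = bin A mV (un A sV x) (un A sV y);
  tV_dS : forall x, un A dV (un A tV x) = un A tO (un A dS x);
  tV_cS : forall x, un A cV (un A tV x) = un A tO (un A cS x);
  tV_iS : forall x, un A tV (un A iS x) = un A iV (un A tO x);
  tV_mS : forall x y, def A mS x y ->
    un A tV (bin A mS x y) = bin A mV (un A tV x) (un A tV y);
  uV_dV : forall x, un A dS (un A uV x) = un A uO (un A dV x);
  uV_cV : forall x, un A cS (un A uV x) = un A uO (un A cV x);
  uV_iV : forall x, un A uV (un A iV x) = un A iS (un A uO x);
  uV_mV : forall x y, def A mV x y ->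
    un A uV (bin A mV x y) = bin A mS (un A uV x) (un A uV y);
  hV_dS : forall x y, def A hV x y ->
    un A dS (bin A hV x y) = bin A hO (un A dS x) (un A dS y);
  hV_cS : forall x y, def A hV x y ->
    un A cS (bin A hV x y) = bin A hO (un A cS x) (un A cS y);
  hV_iS : forall x y, def A hO x y ->
    bin A hV (un A iS x) (un A iS y) = un A iS (bin A hO x y);
  interchange : forall a b c d,
    def A hV a b -> def A hV c d -> def A mS a c -> def A mS b d ->
    bin A hV (bin A mS a c) (bin A mS b d) = bin A mS (bin A hV a b) (bin A hV c d)
}.

Arguments lft_nul [A] _ [s t] b x.
Arguments rgt_nul [A] _ [s t] b x.
Arguments lft_bin [A] _ [s t] b x y _.
Arguments rgt_bin [A] _ [s t] b x y _.
Arguments bin_nul_l [A] _ [s t] b x.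
Arguments bin_nul_r [A] _ [s t] b x.
Arguments bin_assoc [A] _ [s t] b x y z _ _.
Arguments sV_mS [A] _ x y _.
Arguments tV_mS [A] _ x y _.
Arguments uV_mV [A] _ x y _.
Arguments hV_dS [A] _ x y _.
Arguments hV_cS [A] _ x y _.
Arguments hV_iS [A] _ x y _.
Arguments interchange [A] _ a b c d _ _ _ _.

Definition alg_of (D : dblcat) : alg := {|
  car := fun s => match s with
    | SO => ob (d0 D) | SV => mor (d0 D) | SH => ob (d1 D) | SS => mor (d1 D) end;
  un := fun s t u => match u with
    | dV => @dom (d0 D) | cV => @cod (d0 D) | iV => @idm (d0 D)
    | dS => @dom (d1 D) | cS => @cod (d1 D) | iS => @idm (d1 D)
    | sO => fob src | tO => fob tgt | uO => fob hunit
    | sV => fmor src | tV => fmor tgt | uV => fmor hunit end;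
  bin := fun s t b => match b with
    | mV => @tc (d0 D) | mS => @tc (d1 D)
    | hO => @tc (hcat_ob D) | hV => @tc (hcat_sq D) end |}.

Lemma alg_of_lawful D : lawful (alg_of D).
Proof.
split; unfold def.
- intros s t []; [exact (dom_idm (d0 D))|exact (dom_idm (d1 D))
   |exact (dom_idm (hcat_ob D))|exact (dom_idm (hcat_sq D))].
- intros s t []; [exact (cod_idm (d0 D))|exact (cod_idm (d1 D))
   |exact (cod_idm (hcat_ob D))|exact (cod_idm (hcat_sq D))].
- intros s t []; [exact (@dom_tc (d0 D))|exact (@dom_tc (d1 D))
   |exact (@dom_tc (hcat_ob D))|exact (@dom_tc (hcat_sq D))].
- intros s t []; [exact (@cod_tc (d0 D))|exact (@cod_tc (d1 D))
   |exact (@cod_tc (hcat_ob D))|exact (@cod_tc (hcat_sq D))].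
- intros s t [] x; [exact (@tc_idl (d0 D) x _ eq_refl)|exact (@tc_idl (d1 D) x _ eq_refl)
   |exact (@tc_idl (hcat_ob D) x _ eq_refl)|exact (@tc_idl (hcat_sq D) x _ eq_refl)].
- intros s t [] x; [exact (@tc_idr (d0 D) x _ eq_refl)|exact (@tc_idr (d1 D) x _ eq_refl)
   |exact (@tc_idr (hcat_ob D) x _ eq_refl)|exact (@tc_idr (hcat_sq D) x _ eq_refl)].
- intros s t []; [exact (@tcA (d0 D))|exact (@tcA (d1 D))
   |exact (@tcA (hcat_ob D))|exact (@tcA (hcat_sq D))].
- exact (fdom src).
- exact (fcod src).
- exact (fidm src).
- exact (fmor_tc src).
- exact (fdom tgt).
- exact (fcod tgt).
- exact (fidm tgt).
- exact (fmor_tc tgt).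
- exact (fdom hunit).
- exact (fcod hunit).
- intros x; symmetry; exact (eq_sym (fidm hunit x)).
- exact (fmor_tc hunit).
- intros x y e; exact (fmor_tc (hdom D) x y e).
- intros x y e; exact (fmor_tc (hcod D) x y e).
- intros x y e; symmetry; exact (fmor_tc (hidm D) x y e).
- intros a b c d ab cd ac bd; simpl in *.
  assert (e : fmor tgt (comp a c ac) = fmor src (comp b d bd)).
  { rewrite !tcE, !fmor_tc by assumption; congruence. }
  assert (e' : cod (fmor hcomp (exist _ (a, b) ab : mor (pb_cat tgt src))) =
          dom (fmor hcomp (exist _ (c, d) cd : mor (pb_cat tgt src)))).
  { rewrite fdom, fcod; f_equal; apply sig_ext; simpl; congruence. }
  pose proof (@hcomp_comp D a b c d ab cd ac bd e e') as H.
  rewrite !tcE in H.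
  rewrite <- (@tcE (hcat_sq D) a b ab), <- (@tcE (hcat_sq D) c d cd).
  etransitivity; [|exact H].
  assert (e'' : fmor tgt (tc a c) = fmor src (tc b d)) by (rewrite <- (tcE _ _ ac), <- (tcE _ _ bd); exact e).
  rewrite <- (@tcE (hcat_sq D) _ _ e''); simpl; f_equal; apply sig_ext; simpl.
  f_equal; symmetry; apply tcE.
Qed.

Definition act X Y (F : dblfunctor X Y) s : car (alg_of X) s -> car (alg_of Y) s :=
  match s with
  | SO => fob (F0 F) | SV => fmor (F0 F) | SH => fob (F1 F) | SS => fmor (F1 F) end.

Arguments act [X Y] F s x.

Lemma act_un X Y (F : dblfunctor X Y) s t (u : uop s t) x :
  act F t (un (alg_of X) u x) = un (alg_of Y) u (act F s x).
Proof.
destruct u; symmetry;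
[ exact (fdom (F0 F) x) | exact (fcod (F0 F) x) | exact (eq_sym (fidm (F0 F) x))
| exact (fdom (F1 F) x) | exact (fcod (F1 F) x) | exact (eq_sym (fidm (F1 F) x))
| exact (fdom (hcat_ob_map F) x) | exact (fcod (hcat_ob_map F) x)
| exact (eq_sym (fidm (hcat_ob_map F) x))
| exact (fdom (hcat_sq_map F) x) | exact (fcod (hcat_sq_map F) x)
| exact (eq_sym (fidm (hcat_sq_map F) x)) ].
Qed.

Lemma act_bin X Y (F : dblfunctor X Y) s t (b : bop s t) x y : def (alg_of X) b x y ->
  act F s (bin (alg_of X) b x y) = bin (alg_of Y) b (act F s x) (act F s y).
Proof.
destruct b; intros e; [exact (fmor_tc (F0 F) x y e) | exact (fmor_tc (F1 F) x y e)
| exact (fmor_tc (hcat_ob_map F) x y e) | exact (fmor_tc (hcat_sq_map F) x y e)].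
Qed.

Lemma act_ext X Y (F G : dblfunctor X Y) :
  (forall s x, act F s x = act G s x) -> F = G.
Proof.
intros e; apply dblfunctor_eq; apply functor_eq;
  [exact (e SO) | exact (e SV) | exact (e SH) | exact (e SS)].
Qed.

Lemma act_comp X Y Z (F : dblfunctor X Y) (G : dblfunctor Y Z) s x :
  act (comp_dbl G F) s x = act G s (act F s x).
Proof. destruct s; reflexivity. Qed.

Lemma hcomp_tc_ob (D : dblcat) (x : ob (pb_cat (@tgt D) src)) :
  fob hcomp x = @tc (hcat_ob D) (fst (proj1_sig x)) (snd (proj1_sig x)).
Proof.
destruct x as [[f g] e]; simpl in *.
rewrite <- (@tcE (hcat_ob D) f g e); reflexivity.
Qed.

Lemma hcomp_tc_sq (D : dblcat) (x : mor (pb_cat (@tgt D) src)) :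
  fmor hcomp x = @tc (hcat_sq D) (fst (proj1_sig x)) (snd (proj1_sig x)).
Proof.
destruct x as [[f g] e]; simpl in *.
rewrite <- (@tcE (hcat_sq D) f g e); reflexivity.
Qed.

Lemma dblfunctor_of X Y (h : forall s, car (alg_of X) s -> car (alg_of Y) s) :
  (forall s t (u : uop s t) x, h t (un (alg_of X) u x) = un (alg_of Y) u (h s x)) ->
  (forall s t (b : bop s t) x y, def (alg_of X) b x y ->
     h s (bin (alg_of X) b x y) = bin (alg_of Y) b (h s x) (h s y)) ->
  exists F : dblfunctor X Y, forall s x, act F s x = h s x.
Proof.
intros hu hb.
unshelve epose (f0 := @Functor (d0 X) (d0 Y) (h SO) (h SV) _ _ _ _).
- intros f; symmetry; exact (hu _ _ dV f).
- intros f; symmetry; exact (hu _ _ cV f).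
- intros f; exact (hu _ _ iV f).
- intros f g e e'; rewrite !tcE; exact (hb _ _ mV f g e).
- unshelve epose (f1 := @Functor (d1 X) (d1 Y) (h SH) (h SS) _ _ _ _).
  + intros f; symmetry; exact (hu _ _ dS f).
  + intros f; symmetry; exact (hu _ _ cS f).
  + intros f; exact (hu _ _ iS f).
  + intros f g e e'; rewrite !tcE; exact (hb _ _ mS f g e).
  + unshelve eexists {| F0 := f0; F1 := f1 |}.
    * apply functor_eq; intros x; symmetry; [exact (hu _ _ sO x)|exact (hu _ _ sV x)].
    * apply functor_eq; intros x; symmetry; [exact (hu _ _ tO x)|exact (hu _ _ tV x)].
    * apply functor_eq; intros x; [exact (hu _ _ uO x)|exact (hu _ _ uV x)].
    * intros e; apply functor_eq; intros [[f g] k].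
      -- pose (p := exist _ (f, g) k : ob (pb_cat (@tgt X) src)).
         transitivity (h SH (@tc (hcat_ob X) f g)); [exact (f_equal (h SH) (hcomp_tc_ob p))|].
         etransitivity; [exact (hb _ _ hO f g k)|symmetry].
         exact (hcomp_tc_ob (fob (pb_pair (f1 \of pb_fst tgt src) (f1 \of pb_snd tgt src) e) p)).
      -- pose (p := exist _ (f, g) k : mor (pb_cat (@tgt X) src)).
         transitivity (h SS (@tc (hcat_sq X) f g)); [exact (f_equal (h SS) (hcomp_tc_sq p))|].
         etransitivity; [exact (hb _ _ hV f g k)|symmetry].
         exact (hcomp_tc_sq (fmor (pb_pair (f1 \of pb_fst tgt src) (f1 \of pb_snd tgt src) e) p)).
    * intros [] x; reflexivity.
Qed.

Section DblOf.
Variables (A : alg) (L : lawful A).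

Definition cat_of s t (b : bop s t) : cat.
Proof.
refine {| ob := car A t; mor := car A s; dom := un A (lft b); cod := un A (rgt b);
  idm := un A (nul b); comp := fun f g _ => bin A b f g |}.
- apply (lft_nul L).
- apply (rgt_nul L).
- intros; apply (lft_bin L); assumption.
- intros; apply (rgt_bin L); assumption.
- intros; apply (bin_nul_l L).
- intros; apply (bin_nul_r L).
- intros; apply (bin_assoc L); assumption.
Defined.

Definition src_of : functor (cat_of mS) (cat_of mV).
Proof.
refine (@Functor (cat_of mS) (cat_of mV) (un A sO) (un A sV) _ _ _ _).
- exact (sV_dS L).
- exact (sV_cS L).
- exact (sV_iS L).
- intros f g e e1; exact (sV_mS L f g e).
Defined.

Definition tgt_of : functor (cat_of mS) (cat_of mV).
Proof.
refine (@Functor (cat_of mS) (cat_of mV) (un A tO) (un A tV) _ _ _ _).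
- exact (tV_dS L).
- exact (tV_cS L).
- exact (tV_iS L).
- intros f g e e1; exact (tV_mS L f g e).
Defined.

Definition hunit_of : functor (cat_of mV) (cat_of mS).
Proof.
refine (@Functor (cat_of mV) (cat_of mS) (un A uO) (un A uV) _ _ _ _).
- exact (uV_dV L).
- exact (uV_cV L).
- exact (uV_iV L).
- intros f g e e1; exact (uV_mV L f g e).
Defined.

Definition hcomp_of : functor (pb_cat tgt_of src_of) (cat_of mS).
Proof.
refine (@Functor (pb_cat tgt_of src_of) (cat_of mS)
  (fun x => bin A hO (fst (proj1_sig x)) (snd (proj1_sig x)))
  (fun x => bin A hV (fst (proj1_sig x)) (snd (proj1_sig x))) _ _ _ _).
- intros [[f g] e]; exact (hV_dS L f g e).
- intros [[f g] e]; exact (hV_cS L f g e).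
- intros [[f g] e]; exact (hV_iS L f g e).
- intros [[f g] e] [[f' g'] e'] k k0.
  pose proof (f_equal (@proj1_sig _ _) k) as k'; simpl in k'; injection k' as k1 k2.
  exact (interchange L _ _ _ _ e e' k1 k2).
Defined.

Definition dbl_of : dblcat.
Proof.
refine {| d0 := cat_of mV; d1 := cat_of mS; src := src_of; tgt := tgt_of;
  hunit := hunit_of; hcomp := hcomp_of |}.
- apply functor_eq; [exact (lft_nul L hO) | exact (lft_nul L hV)].
- apply functor_eq; [exact (rgt_nul L hO) | exact (rgt_nul L hV)].
- apply functor_eq; intros [[f g] e]; [exact (lft_bin L hO f g e) | exact (lft_bin L hV f g e)].
- apply functor_eq; intros [[f g] e]; [exact (rgt_bin L hO f g e) | exact (rgt_bin L hV f g e)].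
- intros e; apply functor_eq; intros f; [exact (bin_nul_l L hO f) | exact (bin_nul_l L hV f)].
- intros e; apply functor_eq; intros f; [exact (bin_nul_r L hO f) | exact (bin_nul_r L hV f)].
- intros triples fg f g h e1 e2 e3; apply functor_eq; intros [[[[x y] e] z] e'];
  [exact (bin_assoc L hO x y z e e') | exact (bin_assoc L hV x y z e e')].
Defined.

(* Both maps are identities; the carriers of [alg_of dbl_of] are only
   convertible to those of [A] once the sort is known. *)
Definition to_dbl s : car A s -> car (alg_of dbl_of) s :=
  match s with SO => fun x => x | SV => fun x => x | SH => fun x => x | SS => fun x => x end.
Definition of_dbl s : car (alg_of dbl_of) s -> car A s :=
  match s with SO => fun x => x | SV => fun x => x | SH => fun x => x | SS => fun x => x end.

Lemma of_dblK s x : to_dbl (@of_dbl s x) = x.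
Proof. destruct s; reflexivity. Qed.

Lemma to_dblK s x : of_dbl (@to_dbl s x) = x.
Proof. destruct s; reflexivity. Qed.

Lemma of_dbl_un s t (u : uop s t) x :
  of_dbl (un (alg_of dbl_of) u x) = un A u (of_dbl x).
Proof. destruct u; reflexivity. Qed.

Lemma of_dbl_bin s t (b : bop s t) x y : def (alg_of dbl_of) b x y ->
  of_dbl (bin (alg_of dbl_of) b x y) = bin A b (of_dbl x) (of_dbl y).
Proof.
intros e; destruct b; simpl.
- exact (eq_sym (@tcE (cat_of mV) x y e)).
- exact (eq_sym (@tcE (cat_of mS) x y e)).
- exact (eq_sym (@tcE (hcat_ob dbl_of) x y e)).
- exact (eq_sym (@tcE (hcat_sq dbl_of) x y e)).
Qed.

End DblOf.

(** Each law is an equation, which may be tested after applying the jointly injective maps [h].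
    Composability is an equation too, so the side conditions of [hb] for nested composites are
    reflected from the [B k] in the same way. *)
Lemma lawful_reflect (K : Type) (A : alg) (B : K -> alg)
    (h : forall k s, car A s -> car (B k) s) :
  (forall k, lawful (B k)) ->
  (forall s x y, (forall k, h k s x = h k s y) -> x = y) ->
  (forall k s t (u : uop s t) x, h k t (un A u x) = un (B k) u (h k s x)) ->
  (forall k s t (b : bop s t) x y, def A b x y ->
     h k s (bin A b x y) = bin (B k) b (h k s x) (h k s y)) ->
  lawful A.
Proof.
intros LB inj hu hb.
assert (hd : forall k s t (b : bop s t) x y, def A b x y -> def (B k) b (h k s x) (h k s y)).
{ intros k s t b x y e; unfold def; rewrite <- !hu; f_equal; exact e. }
assert (db : forall s t (b : bop s t) x y, (forall k, def (B k) b (h k s x) (h k s y)) -> def A b x y).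
{ intros s t b x y e; apply inj; intros k; rewrite !hu; apply e. }
split; intros; apply inj; intros k; rewrite ?hu.
- apply LB.
- apply LB.
- rewrite hb by assumption; apply LB, hd; assumption.
- rewrite hb by assumption; apply LB, hd; assumption.
- rewrite hb, ?hu; [apply LB|].
  apply db; intros k'; unfold def; rewrite ?hu; apply LB.
- rewrite hb, ?hu; [apply LB|].
  apply db; intros k'; unfold def; rewrite ?hu; symmetry; apply LB.
- rewrite !hb; try assumption.
  + apply LB; apply hd; assumption.
  + apply db; intros k'; unfold def; rewrite ?hu, hb by assumption.
    rewrite (lft_bin (LB k')) by (apply hd; assumption); apply hd; assumption.
  + apply db; intros k'; unfold def; rewrite ?hu, hb by assumption.
    rewrite (rgt_bin (LB k')) by (apply hd; assumption); apply hd; assumption.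
- apply LB.
- apply LB.
- apply LB.
- rewrite !hb, ?hu; try assumption; [apply LB; apply hd; assumption|].
  apply db; intros k'; unfold def; simpl; rewrite ?hu.
  rewrite (sV_cS (LB k')), (sV_dS (LB k')); f_equal; apply (hd k' _ _ mS); assumption.
- apply LB.
- apply LB.
- apply LB.
- rewrite !hb, ?hu; try assumption; [apply LB; apply hd; assumption|].
  apply db; intros k'; unfold def; simpl; rewrite ?hu.
  rewrite (tV_cS (LB k')), (tV_dS (LB k')); f_equal; apply (hd k' _ _ mS); assumption.
- apply LB.
- apply LB.
- apply LB.
- rewrite !hb, ?hu; try assumption; [apply LB; apply hd; assumption|].
  apply db; intros k'; unfold def; simpl; rewrite ?hu.
  rewrite (uV_cV (LB k')), (uV_dV (LB k')); f_equal; apply (hd k' _ _ mV); assumption.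
- rewrite !hb, ?hu; try assumption; [apply LB; apply hd; assumption|].
  apply db; intros k'; unfold def; simpl; rewrite ?hu.
  rewrite <- (sV_dS (LB k')), <- (tV_dS (LB k')); f_equal; apply (hd k' _ _ hV); assumption.
- rewrite !hb, ?hu; try assumption; [apply LB; apply hd; assumption|].
  apply db; intros k'; unfold def; simpl; rewrite ?hu.
  rewrite <- (sV_cS (LB k')), <- (tV_cS (LB k')); f_equal; apply (hd k' _ _ hV); assumption.
- rewrite !hb, ?hu; try assumption; [apply LB; apply (hd k _ _ hO); assumption|].
  apply db; intros k'; unfold def; simpl; rewrite ?hu.
  rewrite (tV_iS (LB k')), (sV_iS (LB k')); f_equal; apply (hd k' _ _ hO); assumption.
- rewrite !hb; try assumption.
  + apply LB; apply hd; assumption.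
  + apply db; intros k'; unfold def; simpl; rewrite ?hu, !hb by assumption.
    rewrite (hV_cS (LB k')), (hV_dS (LB k')) by (apply hd; assumption).
    f_equal; apply (hd k' _ _ mS); assumption.
  + apply db; intros k'; unfold def; simpl; rewrite ?hu, !hb by assumption.
    rewrite (tV_mS (LB k')), (sV_mS (LB k')) by (apply hd; assumption).
    f_equal; apply (hd k' _ _ hV); assumption.
Qed.

(* [E] may be large while the image is represented by a small type. *)
Lemma small_image (T : Small) (E : Type) (ev : T -> E) :
  exists (Q : Small) (f : Q -> E),
    (forall x y, f x = f y -> x = y) /\ (forall q, exists t, f q = ev t) /\
    (forall t, exists q, f q = ev t).
Proof.
(* A canonical representative of each fibre of [ev], depending only on the value [ev t]; its fixed
   points form a small copy of the image. *)
pose (rep t := epsilon (inhabits t) (fun t' => ev t' = ev t)).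
assert (repE : forall t, ev (rep t) = ev t).
{ intros t; apply (epsilon_spec (inhabits t) (fun t' => ev t' = ev t)); exists t; reflexivity. }
assert (rep_eq : forall t t', ev t = ev t' -> rep t = rep t').
{ intros t t' e; unfold rep; rewrite e; f_equal; apply proof_irrelevance. }
exists {t | rep t = t}, (fun q => ev (proj1_sig q)); repeat split.
- intros [x ex] [y ey] e; apply sig_ext; simpl in *.
  rewrite <- ex, <- ey; apply rep_eq; exact e.
- intros [t e]; exists t; reflexivity.
- intros t; exists (exist (fun t' => rep t' = t') (rep t) (rep_eq _ _ (repE t))); apply repE.
Qed.

(** * Limits and colimits of double categories *)

Section SmallSubproduct.
Variables (K : Type) (B : K -> dblcat) (T : sort -> Small).
Variable ev : forall s, T s -> forall k, car (alg_of (B k)) s.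
Hypothesis closed_un : forall s t (u : uop s t) x, exists y, forall k,
  ev (s := t) y k = un (alg_of (B k)) u (ev (s := s) x k).
Hypothesis closed_bin : forall s t (b : bop s t) x y,
  (forall k, def (alg_of (B k)) b (ev x k) (ev y k)) ->
  exists z, forall k, ev z k = bin (alg_of (B k)) b (ev x k) (ev y k).

Lemma small_subproduct : exists (L : dblcat) (p : forall k, dblfunctor L (B k)),
  (forall s x y, (forall k, act (p k) s x = act (p k) s y) -> x = y) /\
  (forall s x, exists t : T s, forall k, act (p k) s x = ev t k) /\
  (forall s (t : T s), exists x, forall k, act (p k) s x = ev t k).
Proof.
pose (Qc s := constructive_indefinite_description _ (small_image (@ev s))).
pose (Q s := proj1_sig (Qc s)).
pose (fc s := constructive_indefinite_description _ (proj2_sig (Qc s))).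
pose (h k s (q : Q s) := proj1_sig (fc s) q k).
assert (inj : forall s (x y : Q s), (forall k, h k s x = h k s y) -> x = y).
{ intros s x y e; apply (proj2_sig (fc s)); apply functional_extensionality_dep; exact e. }
assert (toT : forall s (q : Q s), exists t : T s, forall k, h k s q = ev t k).
{ intros s q; destruct (proj2_sig (fc s)) as [_ [H _]]; destruct (H q) as [t e]; exists t.
  intros k; unfold h; rewrite e; reflexivity. }
assert (ofT : forall s (t : T s), exists q : Q s, forall k, h k s q = ev t k).
{ intros s t; destruct (proj2_sig (fc s)) as [_ [_ H]]; destruct (H t) as [q e]; exists q.
  intros k; unfold h; rewrite e; reflexivity. }
assert (Hun : forall s t (u : uop s t) (x : Q s), exists y : Q t,
  forall k, h k t y = un (alg_of (B k)) u (h k s x)).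
{ intros s t u x; destruct (toT s x) as [x' ex], (closed_un u x') as [y' ey].
  destruct (ofT t y') as [y e]; exists y; intros k; rewrite e, ey, ex; reflexivity. }
pose (qun s t u x := constructive_indefinite_description _ (Hun s t u x)).
(* If the composite is undefined at some [k], the junk value [x] is taken. *)
assert (Hbin : forall s t (b : bop s t) (x y : Q s), exists z : Q s,
  (forall k, def (alg_of (B k)) b (h k s x) (h k s y)) ->
  forall k, h k s z = bin (alg_of (B k)) b (h k s x) (h k s y)).
{ intros s t b x y.
  destruct (excluded_middle_informative
    (forall k, def (alg_of (B k)) b (h k s x) (h k s y))) as [d|n]; [|exists x; contradiction].
  destruct (toT s x) as [x' ex], (toT s y) as [y' ey].
  destruct (@closed_bin s t b x' y') as [z' ez].
  - intros k; rewrite <- ex, <- ey; apply d.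
  - destruct (ofT s z') as [z e]; exists z; intros _ k; rewrite e, ez, ex, ey; reflexivity. }
pose (qbin s t b x y := constructive_indefinite_description _ (Hbin s t b x y)).
pose (A := {| car := Q; un := fun s t u x => proj1_sig (qun s t u x);
              bin := fun s t b x y => proj1_sig (qbin s t b x y) |}).
assert (hu : forall k s t (u : uop s t) x, h k t (un A u x) = un (alg_of (B k)) u (h k s x)).
{ intros k s t u x; exact (proj2_sig (qun s t u x) k). }
assert (hb : forall k s t (b : bop s t) x y, def A b x y ->
  h k s (bin A b x y) = bin (alg_of (B k)) b (h k s x) (h k s y)).
{ intros k s t b x y e; apply (proj2_sig (qbin s t b x y)).
  intros k'; unfold def; rewrite <- !hu; f_equal; exact e. }
assert (L : lawful A) by (apply (@lawful_reflect K A (fun k => alg_of (B k)) h); auto using alg_of_lawful).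
assert (P : forall k, exists p : dblfunctor (dbl_of L) (B k),
  forall s x, act p s x = h k s (of_dbl x)).
{ intros k; apply dblfunctor_of.
  - intros s t u x; rewrite of_dbl_un; apply hu.
  - intros s t b x y e; rewrite of_dbl_bin by exact e; apply hb.
    unfold def; rewrite <- !(@of_dbl_un A L); f_equal; exact e. }
pose (pc k := constructive_indefinite_description _ (P k)).
exists (dbl_of L), (fun k => proj1_sig (pc k)); split; [|split].
- intros s x y e; rewrite <- (of_dblK x), <- (of_dblK y); f_equal; apply inj; intros k.
  rewrite <- !(proj2_sig (pc k)); apply e.
- intros s x; destruct (toT s (of_dbl x)) as [t e]; exists t; intros k.
  rewrite (proj2_sig (pc k)); apply e.
- intros s t; destruct (ofT s t) as [x e]; exists (@to_dbl A L s x); intros k.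
  rewrite (proj2_sig (pc k)), to_dblK; apply e.
Qed.

End SmallSubproduct.

(** Joint injectivity makes the elementwise choice of preimages unique, and hence compatible with
    all operations. *)
Lemma jointly_injective_lift (K : Type) (B : K -> dblcat) (L : dblcat)
    (p : forall k, dblfunctor L (B k)) (X : dblcat) (q : forall k, dblfunctor X (B k)) :
  (forall s x y, (forall k, act (p k) s x = act (p k) s y) -> x = y) ->
  (forall s x, exists y, forall k, act (p k) s y = act (q k) s x) ->
  exists u : dblfunctor X L, forall k, comp_dbl (p k) u = q k.
Proof.
intros inj H.
pose (v s x := constructive_indefinite_description _ (H s x)).
assert (vE : forall s x k, act (p k) s (proj1_sig (v s x)) = act (q k) s x)
  by (intros s x; exact (proj2_sig (v s x))).
destruct (@dblfunctor_of X L (fun s x => proj1_sig (v s x))) as [u e].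
- intros s t o x; apply inj; intros k; rewrite act_un, !vE, act_un; reflexivity.
- intros s t b x y e; apply inj; intros k.
  rewrite act_bin, !vE, act_bin; try assumption; [reflexivity|].
  apply inj; intros k'; rewrite !act_un, !vE, <- !act_un; f_equal; exact e.
- exists u; intros k; apply act_ext; intros s x; rewrite act_comp, e; apply vE.
Qed.

Lemma dblcat_complete : complete DBLCAT.
Proof.
intros J D; simpl in *.
pose (compat s (x : forall j, car (alg_of (dob D j)) s) :=
  forall f j j' (fj : dom f = j) (fj' : cod f = j'), act (dmor D f fj fj') s (x j) = x j').
destruct (@small_subproduct (ob J) (dob D) (fun s => {x | compat s x}) (fun s x => proj1_sig x))
  as [L [p [inj [pT Tp]]]].
- intros s t u [x cx].
  assert (c : compat t (fun j => un (alg_of (dob D j)) u (x j))).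
  { intros f j j' fj fj'; rewrite act_un, cx; reflexivity. }
  exists (exist _ _ c); reflexivity.
- intros s t b [x cx] [y cy] d; simpl in d.
  assert (c : compat s (fun j => bin (alg_of (dob D j)) b (x j) (y j))).
  { intros f j j' fj fj'; rewrite act_bin, cx, cy; [reflexivity | apply d]. }
  exists (exist _ _ c); reflexivity.
- exists L, p; split.
  + intros f j j' fj fj'; apply act_ext; intros s x; simpl; rewrite act_comp.
    destruct (pT s x) as [[t ct] e]; rewrite !e; apply ct.
  + intros X k ck; destruct (@jointly_injective_lift _ _ L p X k inj) as [u pu].
    * intros s x.
      assert (c : compat s (fun j => act (k j) s x)).
      { intros f j j' fj fj'; rewrite <- act_comp; f_equal; exact (ck f j j' fj fj'). }
      destruct (Tp s (exist _ _ c)) as [y e]; exists y; exact e.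
    * exists u; split; [exact pu|]; intros u' pu'; apply act_ext; intros s x.
      apply inj; intros j; rewrite <- !act_comp, pu; f_equal; symmetry; exact (pu' j).
Qed.

Section Colimit.
Variables (J : cat) (D : diagram DBLCAT J).

Inductive term : sort -> Small :=
| tgen : forall s (j : ob J), car (alg_of (dob D j)) s -> term s
| tun : forall s t, uop s t -> term s -> term t
| tbin : forall s t, bop s t -> term s -> term s -> term s.

Arguments tgen [s] j _.

(** The large index type for [small_subproduct]: identifying terms with equal values in every cocone
    gives the quotient of the term algebra with the required universal property. *)
Definition cocone := {X : dblcat & {l : forall j, dblfunctor (dob D j) X |
  is_cocone (C := DBLCAT) D X l}}.

Definition leg (k : cocone) j : dblfunctor (dob D j) (projT1 k) := proj1_sig (projT2 k) j.

Fixpoint eval (k : cocone) s (x : term s) : car (alg_of (projT1 k)) s :=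
  match x with
  | tgen j a => act (leg k j) _ a
  | tun u x => un _ u (eval k x)
  | tbin b x y => bin _ b (eval k x) (eval k y)
  end.

(* Terms with undefined compositions evaluate to junk values, which a double
   functor out of the colimit need not preserve; they are excluded. *)
Fixpoint wd s (x : term s) : Prop :=
  match x with
  | tgen _ _ => True
  | tun _ x => wd x
  | tbin b x y => wd x /\ wd y /\
      forall k, def (alg_of (projT1 k)) b (eval k x) (eval k y)
  end.

Lemma diagram_colimit : exists L l, is_colimit D L l.
Proof.
destruct (@small_subproduct cocone (fun k => projT1 k) (fun s => {x : term s | wd x})
  (fun s x k => eval k (proj1_sig x))) as [L [p [inj [pT Tp]]]].
- intros s t u [x wx]; exists (exist (@wd t) (tun u x) wx); reflexivity.
- intros s t b [x wx] [y wy] d; exists (exist (@wd s) (tbin b x y) (conj wx (conj wy d))).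
  reflexivity.
- assert (H : forall j, exists l : dblfunctor (dob D j) L, forall k, comp_dbl (p k) l = leg k j).
  { intros j; apply jointly_injective_lift; [exact inj|]; intros s x.
    destruct (Tp s (exist (@wd s) (tgen j x) I)) as [y e]; exists y; exact e. }
  pose (lc j := constructive_indefinite_description _ (H j)).
  pose (l j := proj1_sig (lc j)).
  assert (pl : forall k j s x, act (p k) s (act (l j) s x) = act (leg k j) s x).
  { intros k j s x; rewrite <- act_comp; f_equal; exact (proj2_sig (lc j) k). }
  exists L, l; split.
  + intros f i j fi fj; apply act_ext; intros s x; apply inj; intros k.
    simpl; rewrite act_comp, !pl, <- act_comp; f_equal.
    exact (proj2_sig (projT2 k) f i j fi fj).
  + intros X m cm.
    (* The given cocone is one of the indices, so the mediating double functor is simply the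
       projection [p k0]. *)
    pose (k0 := existT _ X (exist _ m cm) : cocone).
    exists (p k0); split.
    * intros j; apply act_ext; intros s x; simpl; rewrite act_comp; exact (pl k0 j s x).
    * intros u um.
      (* Uniqueness: every element of [L] is named by a well-defined term, and induction on that
         term forces the value of [u]. *)
      assert (E : forall s (x : term s), wd x -> forall y,
        (forall k, act (p k) s y = eval k x) -> act u s y = eval k0 x).
      { intros s x; induction x as [s j a|s t o x IH|s t b x IHx y IHy]; intros w z ez.
        - replace z with (act (l j) s a) by (apply inj; intros k; rewrite ez; apply pl).
          rewrite <- act_comp; simpl; f_equal; exact (um j).
        - destruct (Tp s (exist _ x w)) as [x' ex].
          replace z with (un (alg_of L) o x').
          + rewrite act_un, (IH w x' ex); reflexivity.
          + apply inj; intros k; rewrite act_un, ez, ex; reflexivity.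
        - destruct w as [wx [wy d]].
          destruct (Tp s (exist _ x wx)) as [x' ex], (Tp s (exist _ y wy)) as [y' ey].
          assert (d' : def (alg_of L) b x' y').
          { apply inj; intros k; rewrite !act_un, ex, ey; apply d. }
          replace z with (bin (alg_of L) b x' y').
          + rewrite act_bin, (IHx wx x' ex), (IHy wy y' ey) by exact d'; reflexivity.
          + apply inj; intros k; rewrite act_bin, ez, ex, ey by exact d'; reflexivity. }
      apply act_ext; intros s y; destruct (pT s y) as [[x w] e].
      transitivity (eval k0 x); [exact (e k0) | symmetry; exact (E s x w y e)].
Qed.

End Colimit.

Lemma dblcat_cocomplete : cocomplete DBLCAT.
Proof. intros J D; apply diagram_colimit. Qed.

(** * Projective categories and the topology *)

Definition projective (P : cat) : Prop :=
  forall A B (p : functor A B), cat_surjective p ->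
  forall g : functor P B, exists u : functor P A, p \of u = g.

Section Free.
Variable X : cat.

Fixpoint chain (x : ob X) (l : list (mor X)) : Prop :=
  match l with
  | nil => True
  | f :: l => dom f = x /\ chain (cod f) l
  end.

Fixpoint target (x : ob X) (l : list (mor X)) : ob X :=
  match l with nil => x | f :: l => target (cod f) l end.

Lemma chain_app l m : forall x, chain x l -> chain (target x l) m -> chain x (l ++ m).
Proof. induction l as [|f l IH]; simpl; [trivial|]; intros x [e c]; auto. Qed.

Lemma target_app l m : forall x, target x (l ++ m) = target (target x l) m.
Proof. induction l as [|f l IH]; simpl; auto. Qed.

(* The free category on the underlying graph of [X]. *)
Definition free : cat.
Proof.
unshelve refine {|
  ob := ob X;
  mor := {p : ob X * list (mor X) | chain (fst p) (snd p)};
  dom := fun p => fst (proj1_sig p);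
  cod := fun p => target (fst (proj1_sig p)) (snd (proj1_sig p));
  idm := fun x => exist _ (x, nil) I;
  comp := fun p q e =>
    exist _ (fst (proj1_sig p), snd (proj1_sig p) ++ snd (proj1_sig q)) _
|}; simpl; intros.
- destruct p as [[x l] c], q as [[y m] d]; simpl in *.
  apply chain_app; [exact c|rewrite e; exact d].
- reflexivity.
- reflexivity.
- reflexivity.
- rewrite target_app, e; reflexivity.
- apply sig_ext; destruct f as [[x l] c]; reflexivity.
- apply sig_ext; destruct f as [[x l] c]; simpl; rewrite app_nil_r; reflexivity.
- apply sig_ext; simpl; rewrite app_assoc; reflexivity.
Defined.

Definition edge (f : mor X) : mor free :=
  exist (fun p => chain (fst p) (snd p)) (dom f, f :: nil) (conj eq_refl I).

Lemma free_ext A (F G : functor free A) :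
  (forall x, fob F x = fob G x) -> (forall f, fmor F (edge f) = fmor G (edge f)) -> F = G.
Proof.
intros eo em; apply functor_eq; [exact eo|].
intros [[x l] c]; simpl in c; revert x c; induction l as [|f l IH]; intros x c.
- assert (e : (exist _ (x, nil) c : mor free) = @idm free x) by (apply sig_ext; reflexivity).
  change (fmor F (exist _ (x, nil) c : mor free) = fmor G (exist _ (x, nil) c : mor free)); rewrite e, !fidm, eo; reflexivity.
- destruct c as [ex c].
  pose (p := exist _ (cod f, l) c : mor free).
  assert (k : cod (edge f) = dom p) by reflexivity.
  assert (e : exist (fun p => chain (fst p) (snd p)) (x, f :: l) (conj ex c) = tc (edge f) p).
  { rewrite <- (tcE _ _ k); apply sig_ext; simpl; rewrite ex; reflexivity. }
  change (fmor F (exist (fun p => chain (fst p) (snd p)) (x, f :: l) (conj ex c)) =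
    fmor G (exist (fun p => chain (fst p) (snd p)) (x, f :: l) (conj ex c))).
  rewrite e, !fmor_tc by exact k; f_equal; [apply em | apply IH].
Qed.

Section FreeMap.
Variables (A : cat) (so : ob X -> ob A) (sm : mor X -> mor A).
Hypotheses (sm_dom : forall f, dom (sm f) = so (dom f))
  (sm_cod : forall f, cod (sm f) = so (cod f)).

Fixpoint path_value (x : ob X) (l : list (mor X)) : mor A :=
  match l with
  | nil => idm (so x)
  | f :: l => tc (sm f) (path_value (cod f) l)
  end.

Lemma path_value_dom l : forall x, chain x l -> dom (path_value x l) = so x.
Proof.
induction l as [|f l IH]; simpl; intros x c; [apply dom_idm|].
destruct c as [<- c]; rewrite dom_tc, sm_dom; [reflexivity|].
rewrite IH by exact c; apply sm_cod.
Qed.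

Lemma path_value_cod l : forall x, chain x l -> cod (path_value x l) = so (target x l).
Proof.
induction l as [|f l IH]; simpl; intros x c; [apply cod_idm|].
destruct c as [<- c]; rewrite cod_tc; [auto|].
rewrite path_value_dom by exact c; apply sm_cod.
Qed.

Lemma path_value_app l m : forall x, chain x l -> chain (target x l) m ->
  path_value x (l ++ m) = tc (path_value x l) (path_value (target x l) m).
Proof.
induction l as [|f l IH]; simpl; intros x c d.
- rewrite tc_idl; [reflexivity|]; rewrite path_value_dom by exact d; reflexivity.
- destruct c as [<- c]; rewrite IH by assumption; symmetry; apply tcA.
  + rewrite path_value_dom by exact c; apply sm_cod.
  + rewrite path_value_dom, path_value_cod by assumption; reflexivity.
Qed.

Lemma free_map : exists F : functor free A,
  (forall x, fob F x = so x) /\ forall f, fmor F (edge f) = sm f.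
Proof.
unshelve eexists (@Functor free A so
  (fun p => path_value (fst (proj1_sig p)) (snd (proj1_sig p))) _ _ _ _).
- intros [[x l] c]; apply path_value_dom; exact c.
- intros [[x l] c]; apply path_value_cod; exact c.
- reflexivity.
- intros [[x l] c] [[y m] d] e e'; simpl in *.
  rewrite tcE; rewrite path_value_app, e; [reflexivity|exact c|rewrite e; exact d].
- split; [reflexivity|]; intros f; simpl; apply tc_idr; rewrite sm_cod; reflexivity.
Qed.

End FreeMap.

(** Objects are lifted first by surjectivity; fullness then lifts each generating arrow between the
    objects already chosen, and freeness extends this to paths. *)
Lemma free_projective : projective free.
Proof.
intros A B p [po pm] g.
assert (Ho : forall x, exists a, fob p a = fob g x) by (intros x; apply po).
pose (so x := proj1_sig (constructive_indefinite_description _ (Ho x))).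
assert (soE : forall x, fob p (so x) = fob g x)
  by (intros x; exact (proj2_sig (constructive_indefinite_description _ (Ho x)))).
assert (Hm : forall f : mor X, exists a, dom a = so (dom f) /\ cod a = so (cod f) /\
  fmor p a = fmor g (edge f)).
{ intros f; apply pm; rewrite ?fdom, ?fcod, soE; reflexivity. }
pose (sm f := proj1_sig (constructive_indefinite_description _ (Hm f))).
assert (smE : forall f, dom (sm f) = so (dom f) /\ cod (sm f) = so (cod f) /\
  fmor p (sm f) = fmor g (edge f))
  by (intros f; exact (proj2_sig (constructive_indefinite_description _ (Hm f)))).
destruct (@free_map A so sm) as [u [uo um]]; [apply smE | apply smE |].
exists u; apply free_ext; intros x; simpl.
- rewrite uo; apply soE.
- rewrite um; apply smE.
Qed.

Lemma free_cover : exists c : functor free X, cat_surjective c.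
Proof.
destruct (@free_map X (fun x => x) (fun f => f)) as [c [co cm]]; try reflexivity.
exists c; split.
- intros x; exists x; apply co.
- intros x y f; rewrite !co; intros <- <-; exists (edge f); auto.
Qed.

End Free.

(** A cover of a projective category is a single categorically surjective functor, which has a
    section; composing the local lift with the section makes it global. *)
Lemma T_epi_lift E B (p : functor E B) : @T_epi CAT tau' E B p ->
  forall P, projective P -> forall g : functor P B, exists u : functor P E, p \of u = g.
Proof.
intros H P Pp g; destruct (H P g) as [I [U [f [u [[[i _] fs] e]]]]].
destruct (Pp _ _ _ (fs i) (idF P)) as [s fsid].
exists (u i \of s); rewrite compF_assoc.
transitivity (g \of f i \of s); [f_equal; exact (e i)|].
rewrite <- compF_assoc, fsid; apply compF_idr.
Qed.

(** The free category on [X] is projective, so its covering functor serves as the covering family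
    for every [g]. *)
Lemma lift_T_epi E B (p : functor E B) :
  (forall P, projective P -> forall g : functor P B, exists u : functor P E, p \of u = g) ->
  @T_epi CAT tau' E B p.
Proof.
intros H X g; destruct (free_cover X) as [c cs].
destruct (H (free X) (@free_projective X) (g \of c)) as [u e].
exists unit, (fun _ => free X), (fun _ => c), (fun _ => u); split; [|intros i; exact e].
split; [|intros i; exact cs].
exists tt; split; [exact I|intros []; reflexivity].
Qed.

Section Sum.
Variables A B : cat.

(** The mixed cases of [comp] never satisfy [cod f = dom g]; the value [f] there is a
    placeholder. *)
Definition sum_cat : cat.
Proof.
refine {|
  ob := (ob A + ob B)%type;
  mor := (mor A + mor B)%type;
  dom := fun f => match f with inl f => inl (dom f) | inr f => inr (dom f) end;
  cod := fun f => match f with inl f => inl (cod f) | inr f => inr (cod f) end;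
  idm := fun x => match x with inl x => inl (idm x) | inr x => inr (idm x) end;
  comp := fun f g _ => match f, g with
    | inl f, inl g => inl (tc f g) | inr f, inr g => inr (tc f g) | _, _ => f end
|};
  intros; repeat match goal with x : (_ + _)%type |- _ => destruct x end;
  simpl in *; try discriminate;
  f_equal; first [apply dom_idm | apply cod_idm | apply dom_tc | apply cod_tc
    | apply tc_idl | apply tc_idr | apply tcA]; congruence.
Defined.

Definition inlF : functor A sum_cat.
Proof.
refine (@Functor A sum_cat inl inl _ _ _ _); try reflexivity.
intros f g e e'; simpl; f_equal; apply tcE.
Defined.

Definition inrF : functor B sum_cat.
Proof.
refine (@Functor B sum_cat inr inr _ _ _ _); try reflexivity.
intros f g e e'; simpl; f_equal; apply tcE.
Defined.

Definition copair C (F : functor A C) (G : functor B C) : functor sum_cat C.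
Proof.
refine (@Functor sum_cat C
  (fun x => match x with inl x => fob F x | inr x => fob G x end)
  (fun x => match x with inl x => fmor F x | inr x => fmor G x end) _ _ _ _).
- intros [f|f]; apply fdom.
- intros [f|f]; apply fcod.
- intros [f|f]; apply fidm.
- intros [f|f] [g|g] e e'; try discriminate; simpl; rewrite tcE;
    apply fmor_tc; simpl in e; congruence.
Defined.

Lemma copair_inl C (F : functor A C) (G : functor B C) : copair F G \of inlF = F.
Proof. apply functor_eq; reflexivity. Qed.

Lemma copair_inr C (F : functor A C) (G : functor B C) : copair F G \of inrF = G.
Proof. apply functor_eq; reflexivity. Qed.

Lemma sum_ext C (F G : functor sum_cat C) :
  F \of inlF = G \of inlF -> F \of inrF = G \of inrF -> F = G.
Proof.
intros el er; apply functor_eq; intros [x|x];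
  [exact (fob_eq el x) | exact (fob_eq er x) | exact (fmor_eq el x) | exact (fmor_eq er x)].
Qed.

End Sum.

(** * Equivalences and isofibrations of ordinary categories *)

(** Proves equations between endpoints; it calls itself for the composability conditions of nested
    composites. *)
Ltac dc := repeat first [rewrite dom_tc by dc | rewrite cod_tc by dc
  | rewrite dom_idm | rewrite cod_idm | rewrite fdom | rewrite fcod]; congruence.

Lemma inverse_tc (A : cat) (f g : mor A) : inverse A f g <->
  cod f = dom g /\ cod g = dom f /\ tc f g = idm (dom f) /\ tc g f = idm (dom g).
Proof.
split.
- intros [e [e' [fg gf]]]; rewrite !tcE in *; auto.
- intros [e [e' [fg gf]]]; exists e, e'; rewrite !tcE; auto.
Qed.

Lemma inverse_comp (A : cat) (f f' g g' : mor A) : cod f = dom g ->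
  inverse A f f' -> inverse A g g' -> inverse A (tc f g) (tc g' f').
Proof.
rewrite !inverse_tc; intros e [f1 [f2 [f3 f4]]] [g1 [g2 [g3 g4]]].
assert (e' : cod g' = dom f') by congruence.
repeat split; try dc.
- rewrite tcA, <- (@tcA _ g g' f'), g3 by dc; rewrite tc_idl, f3 by dc; f_equal; dc.
- rewrite tcA, <- (@tcA _ f' f g), f4 by dc; rewrite tc_idl, g4 by dc; f_equal; dc.
Qed.

Lemma invertible_comp (A : cat) (f g : mor A) : cod f = dom g ->
  invertible A f -> invertible A g -> invertible A (tc f g).
Proof. intros e [f' If] [g' Ig]; exists (tc g' f'); apply inverse_comp; assumption. Qed.

Lemma inverse_idm (A : cat) (x : ob A) : inverse A (idm x) (idm x).
Proof.
apply inverse_tc; rewrite dom_idm, cod_idm, tc_idl by (rewrite dom_idm; reflexivity); auto.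
Qed.

Definition full A B (F : functor A B) : Prop := forall (x y : ob A) (b : mor B),
  dom b = fob F x -> cod b = fob F y -> exists a, dom a = x /\ cod a = y /\ fmor F a = b.

Definition faithful A B (F : functor A B) : Prop := forall a a' : mor A,
  dom a = dom a' -> cod a = cod a' -> fmor F a = fmor F a' -> a = a'.

Definition ff A B (F : functor A B) : Prop := full F /\ faithful F.

Definition eso A B (F : functor A B) : Prop := forall y, exists x b,
  invertible B b /\ dom b = y /\ cod b = fob F x.

(** Isomorphisms are lifted with prescribed codomain, matching the pullback along [t] that defines
    [path0]. *)
Definition isofib A B (F : functor A B) : Prop := forall x b,
  invertible B b -> cod b = fob F x ->
  exists a, invertible A a /\ cod a = x /\ fmor F a = b.

Lemma ff_reflects_inverse A B (F : functor A B) a b :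
  ff F -> inverse B (fmor F a) b -> exists a', inverse A a a' /\ fmor F a' = b.
Proof.
intros [Ffull Ffaith]; rewrite inverse_tc, fdom, fcod; intros [e1 [e2 [e3 e4]]].
destruct (Ffull (cod a) (dom a) b) as [a' [d [c e]]]; try congruence.
exists a'; split; [|exact e]; rewrite inverse_tc; repeat split; try congruence.
- apply Ffaith; try dc; rewrite fmor_tc, fidm by congruence; congruence.
- apply Ffaith; try dc; rewrite fmor_tc, fidm by congruence; congruence.
Qed.

Lemma ff_comp A B C (F : functor A B) (G : functor B C) : ff F -> ff G -> ff (G \of F).
Proof.
intros [F1 F2] [G1 G2]; split.
- intros x y c d e; destruct (G1 _ _ _ d e) as [b [bd [bc <-]]].
  destruct (F1 _ _ _ bd bc) as [a [ad [ac <-]]]; exists a; auto.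
- intros a a' d c e; apply F2; try assumption; apply G2; try assumption; dc.
Qed.

Lemma ff_cancel_left A B C (F : functor A B) (G : functor B C) :
  ff G -> ff (G \of F) -> ff F.
Proof.
intros [G1 G2] [H1 H2]; split.
- intros x y b d c; destruct (H1 x y (fmor G b)) as [a [ad [ac e]]]; simpl; try dc.
  exists a; repeat split; try assumption; apply G2; [dc|dc|exact e].
- intros a a' d c e; apply H2; simpl; congruence.
Qed.

(** Any two objects of [B] are isomorphic to objects in the image of [F]. Conjugating by these
    isomorphisms moves a question about [G] to arrows between such objects, where [G \of F] answers
    it. *)
Lemma ff_cancel_right A B C (F : functor A B) (G : functor B C) :
  full F -> eso F -> ff (G \of F) -> ff G.
Proof.
intros F1 E [H1 H2].
assert (K : forall x y, exists a a' u u' v v',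
  inverse B u u' /\ dom u = x /\ cod u = fob F a /\ inverse B v v' /\ dom v = y /\ cod v = fob F a').
{ intros x y; destruct (E x) as [a [u [[u' i] [? ?]]]], (E y) as [a' [v [[v' j] [? ?]]]].
  exists a, a', u, u', v, v'; auto 6. }
split.
- intros x y c d e.
  destruct (K x y) as [a [a' [u [u' [v [v' [i [ud [uc [j [vd vc]]]]]]]]]]].
  pose proof (inverse_fmor G i) as Gi; pose proof (inverse_fmor G j) as Gj.
  rewrite inverse_tc in i, j, Gi, Gj; destruct i as [i1 [i2 [i3 i4]]], j as [j1 [j2 [j3 j4]]].
  destruct Gi as [k1 [k2 [k3 k4]]], Gj as [l1 [l2 [l3 l4]]].
  (* The conjugate of [c] runs between images under [G \of F]; its lift is conjugated back below. *)
  destruct (H1 a a' (tc (fmor G u') (tc c (fmor G v)))) as [f [fd [fc ef]]]; simpl in *; try dc.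
  exists (tc u (tc (fmor F f) v')); repeat split; try dc.
  rewrite !fmor_tc, ef by dc.
  rewrite (@tcA _ _ _ (fmor G v')), (@tcA _ _ _ (fmor G v')), l3 by dc.
  rewrite (@tc_idr _ c) by dc.
  rewrite <- tcA, k3 by dc; apply tc_idl; dc.
- intros b b' d c e.
  destruct (K (dom b) (cod b)) as [a [a' [u [u' [v [v' [i [ud [uc [j [vd vc]]]]]]]]]]].
  rewrite inverse_tc in i, j; destruct i as [i1 [i2 [i3 i4]]], j as [j1 [j2 [j3 j4]]].
  assert (L : forall b0, dom b0 = dom b -> cod b0 = cod b ->
    exists f, dom f = a /\ cod f = a' /\ fmor F f = tc u' (tc b0 v)).
  { intros b0 ? ?; apply F1; dc. }
  destruct (L b) as [f [fd [fc fe]]]; try reflexivity.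
  destruct (L b') as [f' [fd' [fc' fe']]]; try congruence.
  assert (f = f').
  { apply H2; simpl; try congruence; rewrite fe, fe', !fmor_tc by dc; congruence. }
  (* Equal conjugates: composing with [u] on the left and [v'] on the right recovers [b] and
     [b']. *)
  subst f'; assert (M : tc u' (tc b v) = tc u' (tc b' v)) by congruence.
  apply (f_equal (fun m => tc (tc u m) v')) in M.
  rewrite <- !(@tcA _ u u'), i3, !tc_idl, !tcA, j3, !tc_idr in M by dc; exact M.
Qed.

Lemma eso_comp A B C (F : functor A B) (G : functor B C) : eso F -> eso G -> eso (G \of F).
Proof.
intros E H z; destruct (H z) as [y [c [ic [cd cc]]]], (E y) as [x [b [ib [bd bc]]]].
exists x, (tc c (fmor G b)); repeat split; simpl; try dc.
apply invertible_comp; [dc|exact ic|apply invertible_fmor; exact ib].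
Qed.

Lemma eso_cancel_left A B C (F : functor A B) (G : functor B C) :
  ff G -> eso (G \of F) -> eso F.
Proof.
intros Gff E y; destruct (E (fob G y)) as [x [c [[c' ic] [cd cc]]]].
destruct (proj1 Gff _ _ _ cd cc) as [b [bd [bc <-]]].
destruct (ff_reflects_inverse Gff ic) as [b' [ib _]].
exists x, b; repeat split; try assumption; exists b'; exact ib.
Qed.

(** The domain of [b] lifts strictly, fullness then lifts [b], and full faithfulness makes the lift
    invertible. *)
Lemma ff_surjective_isofib A B (F : functor A B) :
  ff F -> (forall y, exists x, fob F x = y) -> isofib F.
Proof.
intros Fff S x b [b' ib] bc; destruct (S (dom b)) as [w ew].
destruct (proj1 Fff w x b) as [a [ad [ac <-]]]; auto.
destruct (ff_reflects_inverse Fff ib) as [a' [ia _]].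
exists a; repeat split; try assumption; exists a'; exact ia.
Qed.

Section Retract.
Variables (A B A' B' : cat) (F : functor A B) (G : functor A' B').
Variables (i : functor A A') (r : functor A' A) (j : functor B B') (q : functor B' B).
Hypotheses (ri : r \of i = idF A) (qj : q \of j = idF B)
  (Gi : G \of i = j \of F) (Fr : F \of r = q \of G).

Let riO := fob_eq ri. Let riM := fmor_eq ri. Let qjO := fob_eq qj. Let qjM := fmor_eq qj.
Let GiO := fob_eq Gi. Let GiM := fmor_eq Gi. Let FrO := fob_eq Fr. Let FrM := fmor_eq Fr.

Lemma ff_retract : ff G -> ff F.
Proof.
simpl in *; intros [G1 G2]; split.
- intros x y b d c; destruct (G1 (fob i x) (fob i y) (fmor j b)) as [a [ad [ac ae]]].
  + rewrite fdom, d; symmetry; apply GiO.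
  + rewrite fcod, c; symmetry; apply GiO.
  + exists (fmor r a); rewrite fdom, fcod, ad, ac, riO, riO, FrM, ae, qjM; auto.
- intros a a' d c e; rewrite <- (riM a), <- (riM a'); f_equal; apply G2; dc.
Qed.

Lemma eso_retract : eso G -> eso F.
Proof.
simpl in *; intros E y; destruct (E (fob j y)) as [x [b [ib [d c]]]].
exists (fob r x), (fmor q b); repeat split.
- apply invertible_fmor; exact ib.
- rewrite fdom, d; apply qjO.
- rewrite fcod, c; symmetry; apply FrO.
Qed.

Lemma isofib_retract : isofib G -> isofib F.
Proof.
simpl in *; intros E x b ib c.
destruct (E (fob i x) (fmor j b)) as [a [ia [ac ae]]].
- apply invertible_fmor; exact ib.
- rewrite fcod, c; symmetry; apply GiO.
- exists (fmor r a); repeat split.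
  + apply invertible_fmor; exact ia.
  + rewrite fcod, ac; apply riO.
  + rewrite FrM, ae; apply qjM.
Qed.

End Retract.

(** * Categories of generalized points *)

Section Points.
Variable C : cat.

(* The category of [C]-shaped points of [D], by internal composition. *)
Definition pts (D : dblcat) : cat.
Proof.
refine {| ob := functor C (d0 D); mor := functor C (d1 D);
  dom := fun f => src \of f; cod := fun f => tgt \of f; idm := fun x => hunit \of x;
  comp := fun f g e => hcomp \of pb_pair f g e |}.
- intros x; rewrite compF_assoc, src_hunit; apply compF_idl.
- intros x; rewrite compF_assoc, tgt_hunit; apply compF_idl.
- intros f g e; rewrite compF_assoc, src_hcomp, <- compF_assoc, pb_fst_pair; reflexivity.
- intros f g e; rewrite compF_assoc, tgt_hcomp, <- compF_assoc, pb_snd_pair; reflexivity.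
- intros f e; apply functor_eq; intros x.
  + exact (@comp_idl (hcat_ob D) (fob f x) (f_equal (fun L => fob L x) e)).
  + exact (@comp_idl (hcat_sq D) (fmor f x) (f_equal (fun L => fmor L x) e)).
- intros f e; apply functor_eq; intros x.
  + exact (@comp_idr (hcat_ob D) (fob f x) (f_equal (fun L => fob L x) e)).
  + exact (@comp_idr (hcat_sq D) (fmor f x) (f_equal (fun L => fmor L x) e)).
- intros f g h e1 e2 e3 e4; apply functor_eq; intros x.
  + exact (@comp_assoc (hcat_ob D) (fob f x) (fob g x) (fob h x)
      (f_equal (fun L => fob L x) e1) (f_equal (fun L => fob L x) e2) (f_equal (fun L => fob L x) e3) (f_equal (fun L => fob L x) e4)).
  + exact (@comp_assoc (hcat_sq D) (fmor f x) (fmor g x) (fmor h x)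
      (f_equal (fun L => fmor L x) e1) (f_equal (fun L => fmor L x) e2) (f_equal (fun L => fmor L x) e3) (f_equal (fun L => fmor L x) e4)).
Defined.

Lemma pts_tc_ob D (f g : functor C (d1 D)) (x : ob C) :
  tgt \of f = src \of g -> fob (@tc (pts D) f g) x = @tc (hcat_ob D) (fob f x) (fob g x).
Proof.
intros e; rewrite <- (@tcE (pts D) f g e), <- (@tcE (hcat_ob D) _ _ (fob_eq e x)).
simpl; f_equal; apply sig_ext; reflexivity.
Qed.

Lemma pts_tc_sq D (f g : functor C (d1 D)) (x : mor C) :
  tgt \of f = src \of g -> fmor (@tc (pts D) f g) x = @tc (hcat_sq D) (fmor f x) (fmor g x).
Proof.
intros e; rewrite <- (@tcE (pts D) f g e), <- (@tcE (hcat_sq D) _ _ (fmor_eq e x)).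
simpl; f_equal; apply sig_ext; reflexivity.
Qed.

Definition pts_map X Y (F : dblfunctor X Y) : functor (pts X) (pts Y).
Proof.
refine (@Functor (pts X) (pts Y) (fun x => F0 F \of x) (fun f => F1 F \of f) _ _ _ _).
- intros f; simpl; rewrite !compF_assoc, src_F; reflexivity.
- intros f; simpl; rewrite !compF_assoc, tgt_F; reflexivity.
- intros x; simpl; rewrite !compF_assoc, hunit_F; reflexivity.
- intros f g e e'; rewrite !tcE; apply functor_eq; intros x.
  + rewrite pts_tc_ob by exact e'; simpl; rewrite pts_tc_ob by exact e.
    exact (fmor_tc (hcat_ob_map F) (fob f x) (fob g x) (fob_eq e x)).
  + rewrite pts_tc_sq by exact e'; simpl; rewrite pts_tc_sq by exact e.
    exact (fmor_tc (hcat_sq_map F) (fmor f x) (fmor g x) (fmor_eq e x)).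
Defined.

Lemma pts_map_comp X Y Z (F : dblfunctor X Y) (G : dblfunctor Y Z) :
  pts_map (comp_dbl G F) = pts_map G \of pts_map F.
Proof. apply functor_eq; intros x; symmetry; apply compF_assoc. Qed.

Lemma pts_map_id X : pts_map (id_dbl X) = idF (pts X).
Proof. apply functor_eq; intros x; apply compF_idl. Qed.

End Points.

Lemma pts_inverse_ob C D f g (x : ob C) :
  inverse (pts C D) f g -> inverse (hcat_ob D) (fob f x) (fob g x).
Proof.
rewrite !inverse_tc; intros [e [e' [fg gf]]].
rewrite <- !pts_tc_ob by assumption; rewrite fg, gf; repeat split.
- exact (fob_eq e x).
- exact (fob_eq e' x).
Qed.

Lemma pts_inverse_sq C D f g (x : mor C) :
  inverse (pts C D) f g -> inverse (hcat_sq D) (fmor f x) (fmor g x).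
Proof.
rewrite !inverse_tc; intros [e [e' [fg gf]]].
rewrite <- !pts_tc_sq by assumption; rewrite fg, gf; repeat split.
- exact (fmor_eq e x).
- exact (fmor_eq e' x).
Qed.

Lemma inverse_pts C D (f g : functor C (d1 D)) :
  (forall x, inverse (hcat_ob D) (fob f x) (fob g x)) ->
  (forall x, inverse (hcat_sq D) (fmor f x) (fmor g x)) -> inverse (pts C D) f g.
Proof.
intros io is.
pose proof (fun x => proj1 (inverse_tc _ _) (io x)) as io'.
pose proof (fun x => proj1 (inverse_tc _ _) (is x)) as is'.
assert (e : tgt \of f = src \of g).
{ apply functor_eq; intros x; [exact (proj1 (io' x)) | exact (proj1 (is' x))]. }
assert (e' : tgt \of g = src \of f).
{ apply functor_eq; intros x; [exact (proj1 (proj2 (io' x))) | exact (proj1 (proj2 (is' x)))]. }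
apply inverse_tc; repeat split; try assumption; apply functor_eq; intros x;
  rewrite ?pts_tc_ob, ?pts_tc_sq by assumption.
- exact (proj1 (proj2 (proj2 (io' x)))).
- exact (proj1 (proj2 (proj2 (is' x)))).
- exact (proj2 (proj2 (proj2 (io' x)))).
- exact (proj2 (proj2 (proj2 (is' x)))).
Qed.

(** Chosen preimages are functorial because [M] is injective on objects and on arrows. *)
Lemma functor_lift A B (M : functor A B) W (H : functor W B) :
  (forall x y, fob M x = fob M y -> x = y) -> (forall x y, fmor M x = fmor M y -> x = y) ->
  (forall w, exists x, fob M x = fob H w) -> (forall w, exists x, fmor M x = fmor H w) ->
  exists u : functor W A, M \of u = H.
Proof.
intros io im eo em.
pose (uo w := proj1_sig (constructive_indefinite_description _ (eo w))).
pose (um w := proj1_sig (constructive_indefinite_description _ (em w))).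
assert (uoE : forall w, fob M (uo w) = fob H w)
  by (intros w; exact (proj2_sig (constructive_indefinite_description _ (eo w)))).
assert (umE : forall w, fmor M (um w) = fmor H w)
  by (intros w; exact (proj2_sig (constructive_indefinite_description _ (em w)))).
unshelve eexists (@Functor W A uo um _ _ _ _).
- intros f; apply io; rewrite <- fdom, umE, uoE; apply fdom.
- intros f; apply io; rewrite <- fcod, umE, uoE; apply fcod.
- intros x; apply im; rewrite fidm, umE, uoE; apply fidm.
- intros f g e e'; apply im; rewrite !tcE, fmor_tc, !umE by exact e'.
  apply fmor_tc; exact e.
- apply functor_eq; [exact uoE | exact umE].
Qed.

(** * Elementwise descriptions *)

(** A pullback in [CAT] is one on objects and one on arrows. The former concerns horizontal
    morphisms, the latter squares. *)
Lemma fully_faithful_elementwise A B (F : dblfunctor A B) :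
  fully_faithful F -> ff (hcat_ob_map F) /\ ff (hcat_sq_map F).
Proof.
intros [e univ]; simpl in *.
set (G := prod_map (F0 F) (F0 F)) in *; set (st := prod_pair (@src A) tgt) in *.
set (st' := prod_pair (@src B) tgt) in *.
(* The values of [v] on the canonical pullback witness fullness; that [v] retracts the comparison
   [w] gives faithfulness. *)
destruct (univ _ _ _ (pb_commutes G st')) as [v [[v1 v2] _]].
set (w := pb_pair st (F1 F) e).
assert (vw : v \of w = idF _).
{ destruct (univ _ st (F1 F) e) as [u [_ uniq]].
  transitivity u; [symmetry|]; apply uniq; split; try (apply functor_eq; reflexivity).
  - rewrite compF_assoc, v1; apply functor_eq; reflexivity.
  - rewrite compF_assoc, v2; apply functor_eq; reflexivity. }
split; split.
- intros x y b d c; simpl in d, c.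
  assert (k : fob G (x, y) = fob st' b) by (simpl; congruence).
  pose (t := exist _ ((x, y), b) k : ob (pb_cat G st')).
  exists (fob v t); pose proof (fob_eq v1 t) as k1; pose proof (fob_eq v2 t) as k2.
  simpl in *; injection k1; auto.
- intros a a' d c k; transitivity (fob v (fob w a)); [symmetry; exact (fob_eq vw a)|].
  transitivity (fob v (fob w a')); [|exact (fob_eq vw a')]; f_equal.
  apply sig_ext; simpl in *; congruence.
- intros x y b d c; simpl in d, c.
  assert (k : fmor G (x, y) = fmor st' b) by (simpl; congruence).
  pose (t := exist _ ((x, y), b) k : mor (pb_cat G st')).
  exists (fmor v t); pose proof (fmor_eq v1 t) as k1; pose proof (fmor_eq v2 t) as k2.
  simpl in *; injection k1; auto.
- intros a a' d c k; transitivity (fmor v (fmor w a)); [symmetry; exact (fmor_eq vw a)|].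
  transitivity (fmor v (fmor w a')); [|exact (fmor_eq vw a')]; f_equal.
  apply sig_ext; simpl in *; congruence.
Qed.

Lemma elementwise_fully_faithful A B (F : dblfunctor A B) :
  ff (hcat_ob_map F) -> ff (hcat_sq_map F) -> fully_faithful F.
Proof.
intros [fo io] [fs is]; unfold fully_faithful, is_pullback; simpl; split.
- apply functor_eq; intros x; simpl; f_equal; symmetry;
  [exact (fob_eq (src_F F) x) | exact (fob_eq (tgt_F F) x)
  | exact (fmor_eq (src_F F) x) | exact (fmor_eq (tgt_F F) x)].
- intros W h k e.
  (* [M] records the boundary together with the image under [F]. It is injective by faithfulness,
     and fullness puts the values of [H] in its image. *)
  pose (M := prod_pair (prod_pair (@src A) tgt) (F1 F)); pose (H := prod_pair h k).
  assert (Mo : forall x y, fob M x = fob M y -> x = y)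
    by (intros x y E; simpl in E; injection E; intros; apply io; assumption).
  assert (Mm : forall x y, fmor M x = fmor M y -> x = y)
    by (intros x y E; simpl in E; injection E; intros; apply is; assumption).
  destruct (@functor_lift _ _ M W H Mo Mm) as [u eu].
  + intros w; pose proof (fob_eq e w) as ew; simpl in ew; injection ew; intros e2 e1.
    destruct (fo (fst (fob h w)) (snd (fob h w)) (fob k w)) as [a [ad [ac ae]]]; simpl in *.
    * symmetry; exact e1.
    * symmetry; exact e2.
    * exists a; rewrite ad, ac, ae; destruct (fob h w); reflexivity.
  + intros w; pose proof (fmor_eq e w) as ew; simpl in ew; injection ew; intros e2 e1.
    destruct (fs (fst (fmor h w)) (snd (fmor h w)) (fmor k w)) as [a [ad [ac ae]]]; simpl in *.
    * symmetry; exact e1.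
    * symmetry; exact e2.
    * exists a; rewrite ad, ac, ae; destruct (fmor h w); reflexivity.
  + exists u; split; [split|].
    * apply functor_eq; intros x;
      [exact (f_equal fst (fob_eq eu x)) | exact (f_equal fst (fmor_eq eu x))].
    * apply functor_eq; intros x;
      [exact (f_equal snd (fob_eq eu x)) | exact (f_equal snd (fmor_eq eu x))].
    * intros u' [e1 e2]; subst h k; apply functor_eq; intros x; [apply Mo|apply Mm].
      -- exact (fob_eq eu x).
      -- exact (fmor_eq eu x).
Qed.

(** This is the universal property of the pullback evaluated at [C]: existence gives fullness,
    uniqueness gives faithfulness. *)
Lemma fully_faithful_pts A B (F : dblfunctor A B) : fully_faithful F ->
  forall C, ff (pts_map C F).
Proof.
intros [e univ] C; simpl in *; split.
- intros x y b d c; simpl in *.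
  destruct (univ C (prod_pair x y) b) as [a [[a1 a2] _]].
  + apply functor_eq; intros t; simpl; f_equal; symmetry;
    [exact (fob_eq d t) | exact (fob_eq c t) | exact (fmor_eq d t) | exact (fmor_eq c t)].
  + exists a; repeat split; try exact a2; apply functor_eq; intros t;
    first [exact (f_equal fst (fob_eq a1 t)) | exact (f_equal fst (fmor_eq a1 t))
      | exact (f_equal snd (fob_eq a1 t)) | exact (f_equal snd (fmor_eq a1 t))].
- intros a a' d c k; simpl in *.
  destruct (univ C (prod_pair src tgt \of a) (F1 F \of a)) as [u [_ uniq]].
  + rewrite !compF_assoc, e; reflexivity.
  + transitivity u; [symmetry|]; apply uniq; split; auto.
    apply functor_eq; intros t; simpl; f_equal; symmetry;
    [exact (fob_eq d t) | exact (fob_eq c t) | exact (fmor_eq d t) | exact (fmor_eq c t)].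
Qed.

(** The inverses are vertically composable since [cod f'] and [dom g'] both invert the common
    boundary; interchange gives the two inverse equations. *)
Lemma inverse_vcomp (D : dblcat) (f f' g g' : mor (d1 D)) : cod f = dom g ->
  inverse (hcat_sq D) f f' -> inverse (hcat_sq D) g g' ->
  inverse (hcat_sq D) (tc f g) (tc f' g').
Proof.
intros e If Ig.
assert (e' : cod (c := d1 D) f' = dom (c := d1 D) g').
{ apply (inverse_unique (A := hcat_ob D) (f := cod (c := d1 D) f)).
  - exact (inverse_fmor (hcod D) If).
  - rewrite e; exact (inverse_fmor (hdom D) Ig). }
rewrite inverse_tc in *; destruct If as [f1 [f2 [f3 f4]]], Ig as [g1 [g2 [g3 g4]]].
simpl in f1, f2, f3, f4, g1, g2, g3, g4 |- *.
rewrite !fmor_tc by assumption; repeat split; try congruence.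
- etransitivity; [exact (interchange (alg_of_lawful D) f f' g g' f1 g1 e e')|]; simpl.
  rewrite f3, g3; symmetry; apply fmor_tc; dc.
- etransitivity; [exact (interchange (alg_of_lawful D) f' f g' g f2 g2 e' e)|]; simpl.
  rewrite f4, g4; symmetry; apply fmor_tc; dc.
Qed.

(** Uniqueness of horizontal inverses makes their choice functorial in the vertical direction. *)
Lemma iso1_inverse (D : dblcat) : exists j : functor (iso1 D) (d1 D),
  (forall x, inverse (hcat_ob D) (proj1_sig x) (fob j x)) /\
  (forall f, inverse (hcat_sq D) (proj1_sig f) (fmor j f)).
Proof.
pose (jo (x : ob (iso1 D)) := proj1_sig (constructive_indefinite_description _ (proj2_sig x))).
pose (jm (f : mor (iso1 D)) := proj1_sig (constructive_indefinite_description _ (proj2_sig f))).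
assert (joE : forall x, inverse (hcat_ob D) (proj1_sig x) (jo x))
  by (intros x; exact (proj2_sig (constructive_indefinite_description _ (proj2_sig x)))).
assert (jmE : forall f, inverse (hcat_sq D) (proj1_sig f) (jm f))
  by (intros f; exact (proj2_sig (constructive_indefinite_description _ (proj2_sig f)))).
unshelve eexists (@Functor (iso1 D) (d1 D) jo jm _ _ _ _); [| | | |split; assumption].
- intros f; exact (inverse_unique (inverse_fmor (hdom D) (jmE f)) (joE (dom f))).
- intros f; exact (inverse_unique (inverse_fmor (hcod D) (jmE f)) (joE (cod f))).
- intros x; exact (inverse_unique (jmE (idm x)) (inverse_fmor (hidm D) (joE x))).
- intros f g e e'; apply (inverse_unique (jmE (comp f g e))); simpl; rewrite !tcE.
  apply inverse_vcomp; try apply jmE; exact (f_equal (@proj1_sig _ _) e).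
Qed.

(** Together with [pt_iso1], this identifies functors into [iso1 D] with isomorphisms between
    generalized points. *)
Lemma iso1_pt C D (f : functor C (iso1 D)) : invertible (pts C D) (iso1_incl D \of f).
Proof.
destruct (iso1_inverse D) as [j [jo jm]]; exists (j \of f).
apply inverse_pts; intros x; [apply jo | apply jm].
Qed.

Lemma pt_iso1 C D b : invertible (pts C D) b ->
  exists f : functor C (iso1 D), iso1_incl D \of f = b.
Proof.
intros [b' i]; apply functor_lift.
- intros x y; apply sig_ext.
- intros x y; apply sig_ext.
- intros w; unshelve eexists (exist _ (fob b w) _); [|reflexivity].
  exists (fob b' w); apply pts_inverse_ob; exact i.
- intros w; unshelve eexists (exist _ (fmor b w) _); [|reflexivity].
  exists (fmor b' w); apply pts_inverse_sq; exact i.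
Qed.

Lemma iso1_incl_mono C D (f g : functor C (iso1 D)) :
  iso1_incl D \of f = iso1_incl D \of g -> f = g.
Proof.
intros e; apply functor_eq; intros x; apply sig_ext; [exact (fob_eq e x) | exact (fmor_eq e x)].
Qed.

Lemma pb_ext W A B C (F : functor A C) (G : functor B C) (u v : functor W (pb_cat F G)) :
  pb_fst F G \of u = pb_fst F G \of v -> pb_snd F G \of u = pb_snd F G \of v -> u = v.
Proof.
intros e1 e2; apply functor_eq; intros x; apply sig_ext.
- pose proof (fob_eq e1 x); pose proof (fob_eq e2 x); simpl in *.
  destruct (fob u x) as [[? ?] ?], (fob v x) as [[? ?] ?]; simpl in *; congruence.
- pose proof (fmor_eq e1 x); pose proof (fmor_eq e2 x); simpl in *.
  destruct (fmor u x) as [[? ?] ?], (fmor v x) as [[? ?] ?]; simpl in *; congruence.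
Qed.

(** A point of [path0 F] over [P] is an object [x] of [pts P A] with an isomorphism onto [F x], so
    lifting a point [y] along the source is essential surjectivity at [y]. *)
Lemma ess_surjective_pts A B (F : dblfunctor A B) :
  ess_surjective tau' F <-> forall P, projective P -> eso (pts_map P F).
Proof.
split.
- intros H P Pp y; destruct (T_epi_lift H Pp y) as [u e].
  exists (pb_fst _ _ \of u), (iso1_incl B \of (pb_snd _ _ \of u)); repeat split.
  + apply iso1_pt.
  + rewrite <- e; apply functor_eq; reflexivity.
  + apply functor_eq; intros x; symmetry;
      [exact (proj2_sig (fob u x)) | exact (proj2_sig (fmor u x))].
- intros H; apply lift_T_epi; intros P Pp y.
  destruct (H P Pp y) as [x [b [ib [bd bc]]]]; destruct (pt_iso1 ib) as [f <-].
  simpl in bd, bc; assert (k : F0 F \of x = iso_tgt B \of f)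
    by (rewrite <- bc; apply functor_eq; reflexivity).
  exists (pb_pair x f k); rewrite <- bd; apply functor_eq; reflexivity.
Qed.

(** A point of [path0 F] is an isomorphism lifting problem for [pts_map P F], and a lift of it along
    [r0 F] is a solution. *)
Lemma fib_pts A B (F : dblfunctor A B) :
  fib tau' F <-> forall P, projective P -> isofib (pts_map P F).
Proof.
split.
- intros H P Pp x b ib c; simpl in c; destruct (pt_iso1 ib) as [f <-].
  assert (k : F0 F \of x = iso_tgt B \of f) by (rewrite <- c; apply functor_eq; reflexivity).
  destruct (T_epi_lift H Pp (pb_pair x f k)) as [u e].
  exists (iso1_incl A \of u); repeat split.
  + apply iso1_pt.
  + transitivity (pb_fst _ _ \of (r0 F \of u)); [apply functor_eq; reflexivity|].
    rewrite e; apply functor_eq; reflexivity.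
  + transitivity (iso1_incl B \of (pb_snd _ _ \of (r0 F \of u)));
      [apply functor_eq; reflexivity|].
    rewrite e; apply functor_eq; reflexivity.
- intros H; apply lift_T_epi; intros P Pp g.
  destruct (H P Pp (pb_fst _ _ \of g) (iso1_incl B \of (pb_snd _ _ \of g)))
    as [a [ia [c e]]].
  + apply iso1_pt.
  + apply functor_eq; intros x; symmetry;
      [exact (proj2_sig (fob g x)) | exact (proj2_sig (fmor g x))].
  + destruct (pt_iso1 ia) as [u <-]; exists u; apply pb_ext.
    * rewrite <- c; apply functor_eq; reflexivity.
    * apply iso1_incl_mono; rewrite <- e; apply functor_eq; reflexivity.
Qed.

(** Testing at the identity of [B] gives a cover that factors through [p]; the cover is surjective
    on objects and, being full, on arrows. *)
Lemma T_epi_surjective E B (p : functor E B) : @T_epi CAT tau' E B p ->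
  (forall y, exists x, fob p x = y) /\ (forall g, exists f, fmor p f = g).
Proof.
intros H; destruct (H B (idF B)) as [I [U [f [u [[[i _] fs] e]]]]].
destruct (fs i) as [fo fm]; pose proof (e i) as ei; simpl in ei; split.
- intros y; destruct (fo y) as [x <-]; exists (fob (u i) x); exact (fob_eq ei x).
- intros g; destruct (fo (dom g)) as [x ex], (fo (cod g)) as [y ey].
  destruct (fm x y g) as [h [_ [_ <-]]]; try (symmetry; assumption).
  exists (fmor (u i) h); exact (fmor_eq ei h).
Qed.

Lemma ess_surjective_elementwise A B (F : dblfunctor A B) : ess_surjective tau' F ->
  eso (hcat_ob_map F) /\ eso (hcat_sq_map F).
Proof.
intros H; destruct (T_epi_surjective H) as [Ho Hm]; split.
- intros y; destruct (Ho y) as [[[a [b ib]] k] <-]; exists a, b; simpl in *; auto.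
- intros y; destruct (Hm y) as [[[a [b ib]] k] <-]; exists a, b; simpl in *; auto.
Qed.

(** * Two-out-of-three and closure under retracts *)

Lemma we_pts A B (F : dblfunctor A B) : we tau' F <->
  fully_faithful F /\ forall P, projective P -> eso (pts_map P F).
Proof. unfold we; rewrite ess_surjective_pts; reflexivity. Qed.

Lemma we_comp X Y Z (F : dblfunctor X Y) (G : dblfunctor Y Z) :
  we tau' F -> we tau' G -> we tau' (comp_dbl G F).
Proof.
rewrite !we_pts; intros [F1 F2] [G1 G2]; split.
- destruct (fully_faithful_elementwise F1) as [Fo Fs].
  destruct (fully_faithful_elementwise G1) as [Go Gs].
  apply elementwise_fully_faithful; [exact (ff_comp Fo Go) | exact (ff_comp Fs Gs)].
- intros P Pp; rewrite pts_map_comp; apply eso_comp; auto.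
Qed.

(** Full faithfulness of [G] is checked separately for horizontal morphisms and for squares, since
    [F] is essentially surjective in both senses. An essential preimage [x] under the composite
    gives the preimage [F x] under [G]. *)
Lemma we_cancel_right X Y Z (F : dblfunctor X Y) (G : dblfunctor Y Z) :
  we tau' F -> we tau' (comp_dbl G F) -> we tau' G.
Proof.
intros [F1 F2] H; destruct (ess_surjective_elementwise F2) as [Eo Es].
rewrite we_pts in *; destruct H as [H1 H2]; split.
- destruct (fully_faithful_elementwise F1) as [Fo Fs].
  destruct (fully_faithful_elementwise H1) as [Ho Hs].
  apply elementwise_fully_faithful.
  + apply (ff_cancel_right (F := hcat_ob_map F)); [apply Fo|exact Eo|exact Ho].
  + apply (ff_cancel_right (F := hcat_sq_map F)); [apply Fs|exact Es|exact Hs].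
- intros P Pp y; destruct (H2 P Pp y) as [x [b [ib [bd bc]]]].
  exists (F0 F \of x), b; repeat split; try assumption.
  rewrite bc; apply functor_eq; reflexivity.
Qed.

Lemma we_cancel_left X Y Z (F : dblfunctor X Y) (G : dblfunctor Y Z) :
  we tau' G -> we tau' (comp_dbl G F) -> we tau' F.
Proof.
rewrite !we_pts; intros [G1 G2] [H1 H2]; split.
- destruct (fully_faithful_elementwise G1) as [Go Gs].
  destruct (fully_faithful_elementwise H1) as [Ho Hs].
  apply elementwise_fully_faithful.
  + exact (ff_cancel_left (F := hcat_ob_map F) Go Ho).
  + exact (ff_cancel_left (F := hcat_sq_map F) Gs Hs).
- intros P Pp; apply (eso_cancel_left (F := pts_map P F) (fully_faithful_pts G1 P)).
  rewrite <- pts_map_comp; apply H2; exact Pp.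
Qed.

Lemma act_eq X Y (F G : dblfunctor X Y) s x : F = G -> act F s x = act G s x.
Proof. intros ->; reflexivity. Qed.

Lemma hcat_ob_map_eq X Y Z W (F : dblfunctor X Y) (G : dblfunctor Y Z)
    (F' : dblfunctor X W) (G' : dblfunctor W Z) : comp_dbl G F = comp_dbl G' F' ->
  hcat_ob_map G \of hcat_ob_map F = hcat_ob_map G' \of hcat_ob_map F'.
Proof.
intros e; apply functor_eq; intros x;
  [exact (act_eq (s := SO) x e) | exact (act_eq (s := SH) x e)].
Qed.

Lemma hcat_sq_map_eq X Y Z W (F : dblfunctor X Y) (G : dblfunctor Y Z)
    (F' : dblfunctor X W) (G' : dblfunctor W Z) : comp_dbl G F = comp_dbl G' F' ->
  hcat_sq_map G \of hcat_sq_map F = hcat_sq_map G' \of hcat_sq_map F'.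
Proof.
intros e; apply functor_eq; intros x;
  [exact (act_eq (s := SV) x e) | exact (act_eq (s := SS) x e)].
Qed.

Lemma we_retract : retract_closed (C := DBLCAT) (we tau').
Proof.
intros X Y X' Y' F G [i [r [j [q [ri [qj [Gi Fr]]]]]]]; simpl in *.
intros H; apply we_pts in H; destruct H as [H1 H2]; apply we_pts; split.
- destruct (fully_faithful_elementwise H1) as [Ho Hs]; apply elementwise_fully_faithful.
  + apply (@ff_retract _ _ _ _ (hcat_ob_map F) (hcat_ob_map G) (hcat_ob_map i)
      (hcat_ob_map r) (hcat_ob_map j) (hcat_ob_map q)); try exact Ho;
      first [apply hcat_ob_map_eq; assumption | apply functor_eq; intros x];
      first [exact (act_eq (s := SO) x ri) | exact (act_eq (s := SH) x ri)
        | exact (act_eq (s := SO) x qj) | exact (act_eq (s := SH) x qj)].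
  + apply (@ff_retract _ _ _ _ (hcat_sq_map F) (hcat_sq_map G) (hcat_sq_map i)
      (hcat_sq_map r) (hcat_sq_map j) (hcat_sq_map q)); try exact Hs;
      first [apply hcat_sq_map_eq; assumption | apply functor_eq; intros x];
      first [exact (act_eq (s := SV) x ri) | exact (act_eq (s := SS) x ri)
        | exact (act_eq (s := SV) x qj) | exact (act_eq (s := SS) x qj)].
- intros P Pp; apply (@eso_retract _ _ _ _ (pts_map P F) (pts_map P G)
      (pts_map P r) (pts_map P j) (pts_map P q)); rewrite <- ?pts_map_comp;
    try (f_equal; assumption); rewrite ?qj; auto using pts_map_id.
Qed.

Lemma fib_retract : retract_closed (C := DBLCAT) (fib tau').
Proof.
intros X Y X' Y' F G [i [r [j [q [ri [qj [Gi Fr]]]]]]]; simpl in *.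
intros H; rewrite fib_pts in *; intros P Pp.
apply (@isofib_retract _ _ _ _ (pts_map P F) (pts_map P G) (pts_map P i)
      (pts_map P r) (pts_map P j) (pts_map P q)); rewrite <- ?pts_map_comp;
    try (f_equal; assumption); rewrite ?qj, ?ri; auto using pts_map_id.
Qed.

Lemma dblfunctor_of_functors A B (f0 : functor (d0 A) (d0 B)) (f1 : functor (d1 A) (d1 B)) :
  src \of f1 = f0 \of src -> tgt \of f1 = f0 \of tgt -> f1 \of hunit = hunit \of f0 ->
  (forall x y, fob tgt x = fob src y ->
    fob f1 (@tc (hcat_ob A) x y) = @tc (hcat_ob B) (fob f1 x) (fob f1 y)) ->
  (forall x y, fmor tgt x = fmor src y ->
    fmor f1 (@tc (hcat_sq A) x y) = @tc (hcat_sq B) (fmor f1 x) (fmor f1 y)) ->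
  exists F : dblfunctor A B, F0 F = f0 /\ F1 F = f1.
Proof.
intros es et eu ho hs; unshelve eexists (@DblFunctor A B f0 f1 es et eu _); [|auto].
intros e; apply functor_eq; intros x.
- etransitivity; [exact (f_equal (fob f1) (hcomp_tc_ob x))|].
  etransitivity; [|symmetry; apply hcomp_tc_ob]; apply ho; exact (proj2_sig x).
- etransitivity; [exact (f_equal (fmor f1) (hcomp_tc_sq x))|].
  etransitivity; [|symmetry; apply hcomp_tc_sq]; apply hs; exact (proj2_sig x).
Qed.

(** Fullness over the shape [d1 A] lifts [F1 b] with the boundary prescribed by [f]; preservation of
    units and composites can be checked in [C] because [p] is faithful. *)
Lemma fully_faithful_lift A B C (p : dblfunctor B C) (f : functor (d0 A) (d0 B))
    (b : dblfunctor A C) : fully_faithful p -> F0 p \of f = F0 b ->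
  exists h : dblfunctor A B, F0 h = f /\ comp_dbl p h = b.
Proof.
intros pf e.
destruct (fully_faithful_elementwise pf) as [[_ po] [_ ps]].
destruct (proj1 (fully_faithful_pts pf (d1 A)) (f \of src) (f \of tgt) (F1 b))
  as [f1 [d [c k]]]; simpl in *.
- rewrite compF_assoc, e; apply src_F.
- rewrite compF_assoc, e; apply tgt_F.
- destruct (@dblfunctor_of_functors A B f f1 d c) as [h [h0 h1]].
  + apply (proj2 (fully_faithful_pts pf (d0 A))); simpl.
    * rewrite !compF_assoc, d, src_hunit, <- compF_assoc, src_hunit, compF_idl; apply compF_idr.
    * rewrite !compF_assoc, c, tgt_hunit, <- compF_assoc, tgt_hunit, compF_idl; apply compF_idr.
    * rewrite !compF_assoc, k, hunit_F, (hunit_F p), <- compF_assoc, e; reflexivity.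
  + intros x y xy.
    assert (k1 : fob tgt (fob f1 x) = fob src (fob f1 y)).
    { rewrite (fob_eq c x : fob tgt (fob f1 x) = _), (fob_eq d y : fob src (fob f1 y) = _).
      simpl; f_equal; exact xy. }
    apply po.
    * etransitivity; [exact (fob_eq d _)|].
      etransitivity; [|symmetry; exact (eq_trans (@dom_tc (hcat_ob B) _ _ k1) (fob_eq d x))].
      exact (f_equal (fob f) (@dom_tc (hcat_ob A) x y xy)).
    * etransitivity; [exact (fob_eq c _)|].
      etransitivity; [|symmetry; exact (eq_trans (@cod_tc (hcat_ob B) _ _ k1) (fob_eq c y))].
      exact (f_equal (fob f) (@cod_tc (hcat_ob A) x y xy)).
    * rewrite fmor_tc by exact k1; simpl.
      rewrite (fob_eq k x : fob (F1 p) (fob f1 x) = _), (fob_eq k y : fob (F1 p) (fob f1 y) = _).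
      etransitivity; [exact (fob_eq k _)|]; exact (fmor_tc (hcat_ob_map b) x y xy).
  + intros x y xy.
    assert (k1 : fmor tgt (fmor f1 x) = fmor src (fmor f1 y)).
    { rewrite (fmor_eq c x : fmor tgt (fmor f1 x) = _), (fmor_eq d y : fmor src (fmor f1 y) = _).
      simpl; f_equal; exact xy. }
    apply ps.
    * etransitivity; [exact (fmor_eq d _)|].
      etransitivity; [|symmetry; exact (eq_trans (@dom_tc (hcat_sq B) _ _ k1) (fmor_eq d x))].
      exact (f_equal (fmor f) (@dom_tc (hcat_sq A) x y xy)).
    * etransitivity; [exact (fmor_eq c _)|].
      etransitivity; [|symmetry; exact (eq_trans (@cod_tc (hcat_sq B) _ _ k1) (fmor_eq c y))].
      exact (f_equal (fmor f) (@cod_tc (hcat_sq A) x y xy)).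
    * rewrite fmor_tc by exact k1; simpl.
      rewrite (fmor_eq k x : fmor (F1 p) (fmor f1 x) = _), (fmor_eq k y : fmor (F1 p) (fmor f1 y) = _).
      etransitivity; [exact (fmor_eq k _)|]; exact (fmor_tc (hcat_sq_map b) x y xy).
  + exists h; split; [exact h0|]; apply dblfunctor_eq; simpl; congruence.
Qed.

Lemma fully_faithful_mono A B C (p : dblfunctor B C) (h h' : dblfunctor A B) :
  fully_faithful p -> F0 h = F0 h' -> comp_dbl p h = comp_dbl p h' -> h = h'.
Proof.
intros pf e k; apply dblfunctor_eq; [exact e|].
apply (proj2 (fully_faithful_pts pf (d1 A))); simpl.
- rewrite !src_F, e; reflexivity.
- rewrite !tgt_F, e; reflexivity.
- exact (f_equal (@F1 _ _) k).
Qed.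

(** * Double categories pulled back along a functor of objects *)

Definition prod_fst A B : functor (prod_cat A B) A.
Proof.
refine (@Functor (prod_cat A B) A fst fst _ _ _ _); try reflexivity.
intros f g e e'; apply comp_congr; reflexivity.
Defined.

Definition prod_snd A B : functor (prod_cat A B) B.
Proof.
refine (@Functor (prod_cat A B) B snd snd _ _ _ _); try reflexivity.
intros f g e e'; apply comp_congr; reflexivity.
Defined.

Lemma prod_fst_pair W A B (F : functor W A) (G : functor W B) :
  prod_fst A B \of prod_pair F G = F.
Proof. apply functor_eq; reflexivity. Qed.

Lemma prod_snd_pair W A B (F : functor W A) (G : functor W B) :
  prod_snd A B \of prod_pair F G = G.
Proof. apply functor_eq; reflexivity. Qed.

Lemma prod_pair_comp V W A B (F : functor W A) (G : functor W B) (K : functor V W) :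
  prod_pair F G \of K = prod_pair (F \of K) (G \of K).
Proof. apply functor_eq; reflexivity. Qed.

Lemma prod_map_pair W A B A' B' (F : functor W A) (G : functor W B)
    (H : functor A A') (K : functor B B') :
  prod_map H K \of prod_pair F G = prod_pair (H \of F) (K \of G).
Proof. apply functor_eq; reflexivity. Qed.

Section Pull.
Variables (X : dblcat) (Z0 : cat) (G : functor Z0 (d0 X)).

Local Notation Z1 := (pb_cat (prod_map G G) (prod_pair (@src X) tgt)).

Definition pull_src : functor Z1 Z0 := prod_fst Z0 Z0 \of pb_fst _ _.
Definition pull_tgt : functor Z1 Z0 := prod_snd Z0 Z0 \of pb_fst _ _.

Lemma pull_hunit_commutes :
  prod_map G G \of prod_pair (idF Z0) (idF Z0) = prod_pair src tgt \of (hunit \of G).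
Proof.
rewrite prod_map_pair, prod_pair_comp, !compF_assoc, src_hunit, tgt_hunit.
rewrite compF_idl, compF_idr; reflexivity.
Qed.

Definition pull_hunit : functor Z0 Z1 := pb_pair _ _ pull_hunit_commutes.

Lemma pull_src_snd : G \of pull_src = src \of pb_snd (prod_map G G) (prod_pair (@src X) tgt).
Proof.
apply functor_eq; intros x;
[exact (f_equal fst (proj2_sig x)) | exact (f_equal fst (proj2_sig x))].
Qed.

Lemma pull_tgt_snd : G \of pull_tgt = tgt \of pb_snd (prod_map G G) (prod_pair (@src X) tgt).
Proof.
apply functor_eq; intros x;
[exact (f_equal snd (proj2_sig x)) | exact (f_equal snd (proj2_sig x))].
Qed.

Lemma pull_pairs_commutes :
  tgt \of (pb_snd (prod_map G G) (prod_pair src tgt) \of pb_fst pull_tgt pull_src) =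
  src \of (pb_snd (prod_map G G) (prod_pair src tgt) \of pb_snd pull_tgt pull_src).
Proof.
rewrite !compF_assoc, <- pull_src_snd, <- pull_tgt_snd, <- !compF_assoc, pb_commutes.
reflexivity.
Qed.

Definition pull_pairs : functor (pb_cat pull_tgt pull_src) (pb_cat (@tgt X) src) :=
  pb_pair _ _ pull_pairs_commutes.

Lemma pull_hcomp_commutes :
  prod_map G G \of prod_pair (pull_src \of pb_fst pull_tgt pull_src)
    (pull_tgt \of pb_snd pull_tgt pull_src) =
  prod_pair src tgt \of (hcomp \of pull_pairs).
Proof.
rewrite prod_map_pair, prod_pair_comp, !compF_assoc, src_hcomp, tgt_hcomp.
rewrite pull_src_snd, pull_tgt_snd, <- !compF_assoc; unfold pull_pairs.
rewrite pb_fst_pair, pb_snd_pair; reflexivity.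
Qed.

Definition pull_hcomp : functor (pb_cat pull_tgt pull_src) Z1 :=
  pb_pair _ _ pull_hcomp_commutes.

Lemma pull_hcomp_snd : pb_snd _ _ \of pull_hcomp = hcomp \of pull_pairs.
Proof. apply pb_snd_pair. Qed.

(** The horizontal structure between [z] and [z'] is that of [X] between [G z] and [G z'], so the
    laws are inherited from [X] and the projection is fully faithful by construction. *)
Definition pull : dblcat.
Proof.
refine (@DblCat Z0 Z1 pull_src pull_tgt pull_hunit pull_hcomp _ _ _ _ _ _ _).
- unfold pull_src, pull_hunit; rewrite <- (compF_assoc (prod_fst Z0 Z0)), pb_fst_pair; apply prod_fst_pair.
- unfold pull_tgt, pull_hunit; rewrite <- (compF_assoc (prod_snd Z0 Z0)), pb_fst_pair; apply prod_snd_pair.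
- transitivity (prod_fst Z0 Z0 \of (pb_fst _ _ \of pull_hcomp)); [symmetry; apply compF_assoc|].
  unfold pull_hcomp; rewrite pb_fst_pair; apply prod_fst_pair.
- transitivity (prod_snd Z0 Z0 \of (pb_fst _ _ \of pull_hcomp)); [symmetry; apply compF_assoc|].
  unfold pull_hcomp; rewrite pb_fst_pair; apply prod_snd_pair.
- intros e; apply functor_eq; intros [[[z z'] h] k]; apply sig_ext.
  + refine (f_equal (pair (z, z')) (eq_trans (hcomp_tc_ob _) _)).
    exact (@tc_idl (hcat_ob X) h (fob G z) (f_equal fst k)).
  + refine (f_equal (pair (z, z')) (eq_trans (hcomp_tc_sq _) _)).
    exact (@tc_idl (hcat_sq X) h (fmor G z) (f_equal fst k)).
- intros e; apply functor_eq; intros [[[z z'] h] k]; apply sig_ext.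
  + refine (f_equal (pair (z, z')) (eq_trans (hcomp_tc_ob _) _)).
    exact (@tc_idr (hcat_ob X) h (fob G z') (f_equal snd k)).
  + refine (f_equal (pair (z, z')) (eq_trans (hcomp_tc_sq _) _)).
    exact (@tc_idr (hcat_sq X) h (fmor G z') (f_equal snd k)).
- intros triples fg f g h e1 e2 e3; apply functor_eq;
    intros [[[[[[[a a'] hx] kx] [[[b b'] hy] ky]] e] [[[c c'] hz] kz]] e']; apply sig_ext.
  + assert (exy : @cod (hcat_ob X) hx = @dom (hcat_ob X) hy)
      by exact (eq_trans (eq_sym (f_equal snd kx)) (eq_trans (f_equal (fob G) e) (f_equal fst ky))).
    assert (eyz : @cod (hcat_ob X) hy = @dom (hcat_ob X) hz)
      by exact (eq_trans (eq_sym (f_equal snd ky)) (eq_trans (f_equal (fob G) e') (f_equal fst kz))).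
    refine (f_equal (pair (a, c')) _).
    refine (eq_trans (hcomp_tc_ob _) (eq_trans _ (eq_sym (hcomp_tc_ob _)))).
    refine (eq_trans (f_equal (fun m => @tc (hcat_ob X) m hz) (hcomp_tc_ob _)) _).
    refine (eq_trans (tcA exy eyz) _).
    match goal with |- context [fob (pb_pair f _ e3) ?T] =>
      exact (f_equal (fun m => @tc (hcat_ob X) hx m)
        (eq_sym (hcomp_tc_ob (fob pull_pairs (fob (pb_pair g h e2) T))))) end.
  + assert (exy : @cod (hcat_sq X) hx = @dom (hcat_sq X) hy)
      by exact (eq_trans (eq_sym (f_equal snd kx)) (eq_trans (f_equal (fmor G) e) (f_equal fst ky))).
    assert (eyz : @cod (hcat_sq X) hy = @dom (hcat_sq X) hz)
      by exact (eq_trans (eq_sym (f_equal snd ky)) (eq_trans (f_equal (fmor G) e') (f_equal fst kz))).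
    refine (f_equal (pair (a, c')) _).
    refine (eq_trans (hcomp_tc_sq _) (eq_trans _ (eq_sym (hcomp_tc_sq _)))).
    refine (eq_trans (f_equal (fun m => @tc (hcat_sq X) m hz) (hcomp_tc_sq _)) _).
    refine (eq_trans (tcA exy eyz) _).
    match goal with |- context [fmor (pb_pair f _ e3) ?T] =>
      exact (f_equal (fun m => @tc (hcat_sq X) hx m)
        (eq_sym (hcomp_tc_sq (fmor pull_pairs (fmor (pb_pair g h e2) T))))) end.
Defined.

Definition pull_dblfunctor : dblfunctor pull X.
Proof.
refine (@DblFunctor pull X G (pb_snd (prod_map G G) (prod_pair (@src X) tgt)) _ _ _ _).
- symmetry; exact pull_src_snd.
- symmetry; exact pull_tgt_snd.
- exact (pb_snd_pair pull_hunit_commutes).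
- intros e; transitivity (hcomp \of pull_pairs); [exact pull_hcomp_snd|].
  exact (f_equal (compF hcomp) (pb_pair_eq pull_pairs_commutes e eq_refl eq_refl)).
Defined.

Lemma pull_proj : exists p : dblfunctor pull X, F0 p = G /\ fully_faithful p.
Proof.
exists pull_dblfunctor; split; [reflexivity|].
apply elementwise_fully_faithful; split.
- intros z z' b d c.
  assert (k : (fob G z, fob G z') = (fob src b, fob tgt b)) by (simpl in *; congruence).
  exists (exist _ ((z, z'), b) k); auto.
- intros [[[z z'] b] k] [[[w w'] b'] k'] d c e; apply sig_ext; simpl in *; congruence.
- intros z z' b d c.
  assert (k : (fmor G z, fmor G z') = (fmor src b, fmor tgt b)) by (simpl in *; congruence).
  exists (exist _ ((z, z'), b) k); auto.
- intros [[[z z'] b] k] [[[w w'] b'] k'] d c e; apply sig_ext; simpl in *; congruence.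
Qed.

End Pull.

(** * Conjugation by a horizontal isomorphism *)

(* The functor [phi] is the component of an invertible horizontal
   transformation from [G'] to [G]. *)
Definition nat_iso X Y (phi : functor (d0 X) (d1 Y)) (G' G : dblfunctor X Y) : Prop :=
  invertible (pts (d0 X) Y) phi /\ src \of phi = F0 G' /\ tgt \of phi = F0 G /\
  @tc (pts (d1 X) Y) (F1 G') (phi \of tgt) = @tc (pts (d1 X) Y) (phi \of src) (F1 G).

Definition precomp C C' (K : functor C' C) D : functor (pts C D) (pts C' D).
Proof.
refine (@Functor (pts C D) (pts C' D) (fun x => x \of K) (fun f => f \of K) _ _ _ _);
  try (intros; first [apply compF_assoc | symmetry; apply compF_assoc]).
intros f g e e'; rewrite !tcE; apply functor_eq; intros x; simpl.
- rewrite pts_tc_ob by exact e; rewrite pts_tc_ob by exact e'; reflexivity.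
- rewrite pts_tc_sq by exact e; rewrite pts_tc_sq by exact e'; reflexivity.
Defined.

Lemma conj_tc (A : cat) (p p' q q' s s' g h : mor A) :
  inverse A p p' -> inverse A q q' -> inverse A s s' ->
  cod p = dom g -> cod g = cod q -> cod q = dom h -> cod h = cod s ->
  tc (tc p (tc g h)) s' = tc (tc (tc p g) q') (tc (tc q h) s').
Proof.
rewrite !inverse_tc; intros [p1 [p2 [p3 p4]]] [q1 [q2 [q3 q4]]] [s1 [s2 [s3 s4]]] e1 e2 e3 e4.
rewrite (@tcA _ (tc p g) q'), (@tcA _ q h s'), <- (@tcA _ q' q (tc h s')), q4 by dc.
rewrite tc_idl by dc; rewrite !tcA by dc; reflexivity.
Qed.

(** Transport of structure: the conjugate preserves units because [phi] and its inverse cancel, and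
    composites because the inner pair cancels as in [conj_tc]. *)
Lemma conj_exists X Y (phi : functor (d0 X) (d1 Y)) (G : dblfunctor X Y) :
  invertible (pts (d0 X) Y) phi -> tgt \of phi = F0 G -> exists G', nat_iso phi G' G.
Proof.
intros [psi I] c.
destruct (proj1 (inverse_tc _ _) I) as [i1 [i2 [i3 i4]]]; simpl in i1, i2, i3, i4.
pose (T := pts (d1 X) Y).
pose (ps := phi \of src : mor T); pose (pt := phi \of tgt : mor T).
pose (qt := psi \of tgt : mor T); pose (g := F1 G : mor T).
assert (Is : inverse T ps (psi \of src)) by exact (inverse_fmor (precomp src Y) I).
assert (It : inverse T pt qt) by exact (inverse_fmor (precomp tgt Y) I).
assert (e1 : cod ps = dom g) by (unfold ps, g; simpl; rewrite compF_assoc, c, src_F; reflexivity).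
assert (e2 : cod g = dom qt)
  by (unfold qt, g; simpl; rewrite compF_assoc, <- i1, c, tgt_F; reflexivity).
assert (e3 : cod (tc ps g) = dom qt) by dc.
assert (e4 : cod g = cod pt) by (unfold pt, g; simpl; rewrite compF_assoc, c, tgt_F; reflexivity).
(* The only value allowed by naturality: [phi] at the source, then [G], then the inverse of [phi] at
   the target. *)
pose (f1 := tc (tc ps g) qt).
assert (f1o : forall x, fob f1 x = @tc (hcat_ob Y) (@tc (hcat_ob Y) (fob ps x) (fob g x)) (fob qt x)).
{ intros x; unfold f1, T; rewrite !pts_tc_ob by assumption; reflexivity. }
assert (f1m : forall x, fmor f1 x = @tc (hcat_sq Y) (@tc (hcat_sq Y) (fmor ps x) (fmor g x)) (fmor qt x)).
{ intros x; unfold f1, T; rewrite !pts_tc_sq by assumption; reflexivity. }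
destruct (@dblfunctor_of_functors X Y (src \of phi) f1) as [G' [g0 g1]].
- transitivity (dom f1); [reflexivity|]; unfold f1; rewrite !dom_tc by assumption.
  apply compF_assoc.
- transitivity (cod f1); [reflexivity|]; unfold f1; rewrite !cod_tc by assumption.
  unfold qt; simpl; rewrite compF_assoc, i2; reflexivity.
- transitivity (fmor (precomp hunit Y) f1); [reflexivity|].
  unfold f1; rewrite !fmor_tc by assumption; unfold ps, g, qt; simpl.
  rewrite <- !compF_assoc, src_hunit, tgt_hunit, !compF_idr, hunit_F.
  rewrite (@tc_idr (pts (d0 X) Y) phi (F0 G) (eq_sym c) :
    @tc (pts (d0 X) Y) phi (hunit \of F0 G) = phi); exact i3.
- intros x y k; rewrite !f1o.
  assert (ke : fob pt x = fob ps y) by (unfold pt, ps; simpl; rewrite k; reflexivity).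
  replace (fob ps (@tc (hcat_ob X) x y)) with (fob ps x)
    by (unfold ps; simpl; f_equal; symmetry; exact (@dom_tc (hcat_ob X) x y k)).
  replace (fob qt (@tc (hcat_ob X) x y)) with (fob qt y)
    by (unfold qt; simpl; f_equal; symmetry; exact (@cod_tc (hcat_ob X) x y k)).
  replace (fob g (@tc (hcat_ob X) x y)) with (@tc (hcat_ob Y) (fob g x) (fob g y))
    by (symmetry; exact (fmor_tc (hcat_ob_map G) x y k)).
  rewrite <- ke; apply (@conj_tc (hcat_ob Y) _ _ _ _ _ _ _ _ (pts_inverse_ob x Is)
    (pts_inverse_ob x It) (pts_inverse_ob y It)).
  + exact (fob_eq e1 x).
  + exact (fob_eq e4 x).
  + rewrite ke; exact (fob_eq e1 y).
  + exact (fob_eq e4 y).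
- intros x y k; rewrite !f1m.
  assert (ke : fmor pt x = fmor ps y) by (unfold pt, ps; simpl; rewrite k; reflexivity).
  replace (fmor ps (@tc (hcat_sq X) x y)) with (fmor ps x)
    by (unfold ps; simpl; f_equal; symmetry; exact (@dom_tc (hcat_sq X) x y k)).
  replace (fmor qt (@tc (hcat_sq X) x y)) with (fmor qt y)
    by (unfold qt; simpl; f_equal; symmetry; exact (@cod_tc (hcat_sq X) x y k)).
  replace (fmor g (@tc (hcat_sq X) x y)) with (@tc (hcat_sq Y) (fmor g x) (fmor g y))
    by (symmetry; exact (fmor_tc (hcat_sq_map G) x y k)).
  rewrite <- ke; apply (@conj_tc (hcat_sq Y) _ _ _ _ _ _ _ _ (pts_inverse_sq x Is)
    (pts_inverse_sq x It) (pts_inverse_sq y It)).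
  + exact (fmor_eq e1 x).
  + exact (fmor_eq e4 x).
  + rewrite ke; exact (fmor_eq e1 y).
  + exact (fmor_eq e4 y).
- exists G'; repeat split.
  + exists psi; exact I.
  + symmetry; exact g0.
  + exact c.
  + rewrite g1; fold T ps pt g; unfold f1.
    destruct (proj1 (inverse_tc _ _) It) as [j1 [j2 [j3 j4]]].
    rewrite tcA, j4 by assumption; apply tc_idr; rewrite cod_tc by assumption; congruence.
Qed.

Lemma tc_cancel_right (A : cat) (f g p : mor A) : invertible A p ->
  cod f = dom p -> cod g = dom p -> tc f p = tc g p -> f = g.
Proof.
intros [q i] e1 e2 e; rewrite inverse_tc in i; destruct i as [i1 [i2 [i3 i4]]].
apply (f_equal (fun m => tc m q)) in e.
rewrite !tcA, i3, !tc_idr in e by congruence; exact e.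
Qed.

Lemma nat_iso_composable X Y phi (G' G : dblfunctor X Y) : nat_iso phi G' G ->
  tgt \of F1 G' = src \of (phi \of tgt) /\ tgt \of (phi \of src) = src \of F1 G.
Proof.
intros [_ [s [t _]]]; rewrite !compF_assoc, s, t, src_F, tgt_F; auto.
Qed.

(** Naturality determines [G'] since [phi \of tgt] is cancellable. Equations between double functors
    are proved below by comparing the isomorphisms that define them. *)
Lemma conj_unique X Y phi phi' (G' G'' G H : dblfunctor X Y) :
  phi = phi' -> G = H -> nat_iso phi G' G -> nat_iso phi' G'' H -> G' = G''.
Proof.
intros <- <- n n'.
destruct (nat_iso_composable n) as [c1 _]; destruct (nat_iso_composable n') as [c2 _].
destruct n as [i [s [t e]]], n' as [_ [s' [t' e']]].
apply dblfunctor_eq; [congruence|].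
apply (@tc_cancel_right (pts (d1 X) Y) _ _ (phi \of tgt)); try assumption; [|congruence].
exact (invertible_fmor (precomp tgt Y) i).
Qed.

Lemma nat_iso_refl X Y (G : dblfunctor X Y) : nat_iso (hunit \of F0 G) G G.
Proof.
repeat split.
- exists (hunit \of F0 G); exact (@inverse_idm (pts (d0 X) Y) (F0 G)).
- rewrite compF_assoc, src_hunit; apply compF_idl.
- rewrite compF_assoc, tgt_hunit; apply compF_idl.
- rewrite <- !compF_assoc.
  transitivity (F1 G); [|symmetry].
  + exact (@tc_idr (pts (d1 X) Y) (F1 G) (F0 G \of tgt) (eq_sym (tgt_F G))).
  + exact (@tc_idl (pts (d1 X) Y) (F1 G) (F0 G \of src) (eq_sym (src_F G))).
Qed.

Lemma nat_iso_postcomp X Y W phi (G' G : dblfunctor X Y) (H : dblfunctor Y W) :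
  nat_iso phi G' G -> nat_iso (F1 H \of phi) (comp_dbl H G') (comp_dbl H G).
Proof.
intros n; destruct (nat_iso_composable n) as [c1 c2]; destruct n as [i [s [t e]]].
repeat split; simpl.
- exact (invertible_fmor (pts_map _ H) i).
- rewrite compF_assoc, src_F, <- compF_assoc, s; reflexivity.
- rewrite compF_assoc, tgt_F, <- compF_assoc, t; reflexivity.
- apply (f_equal (fmor (pts_map (d1 X) H))) in e.
  rewrite !fmor_tc in e by assumption; simpl in e; rewrite <- !compF_assoc; exact e.
Qed.

Lemma nat_iso_precomp X Y W phi (G' G : dblfunctor X Y) (K : dblfunctor W X) :
  nat_iso phi G' G -> nat_iso (phi \of F0 K) (comp_dbl G' K) (comp_dbl G K).
Proof.
intros n; destruct (nat_iso_composable n) as [c1 c2]; destruct n as [i [s [t e]]].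
repeat split; simpl.
- exact (invertible_fmor (precomp (F0 K) Y) i).
- rewrite compF_assoc, s; reflexivity.
- rewrite compF_assoc, t; reflexivity.
- apply (f_equal (fmor (precomp (F1 K) Y))) in e.
  rewrite !fmor_tc in e by assumption; simpl in e.
  rewrite <- !compF_assoc, src_F, tgt_F in e; rewrite <- !compF_assoc; exact e.
Qed.

(** Given by its universal property so that the object part of a double functor can serve as an
    inclusion. *)
Definition coproduct A B S (il : functor A S) (ir : functor B S) : Prop :=
  (forall C (F : functor A C) (G : functor B C), exists H, H \of il = F /\ H \of ir = G) /\
  (forall C (H K : functor S C), H \of il = K \of il -> H \of ir = K \of ir -> H = K).

Lemma sum_coproduct A B : coproduct (inlF A B) (inrF A B).
Proof.
split; [|apply sum_ext]; intros C F G; exists (copair F G).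
split; [apply copair_inl | apply copair_inr].
Qed.

(** Copairing takes place in [iso1 D], so the glued point is again invertible. *)
Lemma coproduct_invertible A B S (il : functor A S) (ir : functor B S) D
    (f : functor A (d1 D)) (g : functor B (d1 D)) : coproduct il ir ->
  invertible (pts A D) f -> invertible (pts B D) g ->
  exists h, invertible (pts S D) h /\ h \of il = f /\ h \of ir = g.
Proof.
intros [cp _] If Ig; destruct (pt_iso1 If) as [f' <-], (pt_iso1 Ig) as [g' <-].
destruct (cp _ f' g') as [h [<- <-]]; exists (iso1_incl D \of h).
split; [apply iso1_pt | split; symmetry; apply compF_assoc].
Qed.

(** * Adjoining a projective category of objects *)

(** Essential surjectivity gives an isomorphism from [y] to an image; the source of its lift is a
    strict preimage of [y]. *)
Lemma trivial_fibration_surjective E B (p : dblfunctor E B) :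
  fib tau' p -> we tau' p -> forall P, projective P ->
  forall y : functor P (d0 B), exists x, F0 p \of x = y.
Proof.
rewrite fib_pts, we_pts; intros pf [_ pw] P Pp y.
destruct (pw P Pp y) as [x [b [ib [bd bc]]]], (pf P Pp x b ib bc) as [a [_ [_ ae]]].
exists (src \of a); simpl in *; rewrite compF_assoc, <- src_F, <- compF_assoc, ae; exact bd.
Qed.

Lemma surjective_trivial_fibration E B (p : dblfunctor E B) : fully_faithful p ->
  (forall P, projective P -> forall y : functor P (d0 B), exists x, F0 p \of x = y) ->
  fib tau' p /\ we tau' p.
Proof.
intros pf H; rewrite fib_pts, we_pts; split; [|split; [exact pf|]].
- intros P Pp; apply ff_surjective_isofib; [apply fully_faithful_pts; exact pf|].
  exact (H P Pp).
- intros P Pp y; destruct (H P Pp y) as [x e]; exists x, (hunit \of y); repeat split.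
  + exists (hunit \of y); exact (@inverse_idm (pts P B) y).
  + exact (@dom_idm (pts P B) y).
  + etransitivity; [exact (@cod_idm (pts P B) y)|]; symmetry; exact e.
Qed.

Lemma dbl_assoc X Y Z W (h : dblfunctor Z W) (g : dblfunctor Y Z) (f : dblfunctor X Y) :
  comp_dbl h (comp_dbl g f) = comp_dbl (comp_dbl h g) f.
Proof. exact (@compc_assoc DBLCAT X Y Z W h g f). Qed.

Lemma dbl_idr X Y (f : dblfunctor X Y) : comp_dbl f (id_dbl X) = f.
Proof. exact (@compc_idr DBLCAT X Y f). Qed.

(** [Z] is [Y] pulled back along the copairing of [F0 f] and [c]; full faithfulness of [p] extends
    the left inclusion to a double functor over [f]. *)
Lemma adjoin_objects X Y P (f : dblfunctor X Y) (c : functor P (d0 Y)) :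
  exists Z (i : dblfunctor X Z) (ir : functor P (d0 Z)) (p : dblfunctor Z Y),
    coproduct (F0 i) ir /\ fully_faithful p /\ comp_dbl p i = f /\ F0 p \of ir = c.
Proof.
destruct (pull_proj (copair (F0 f) c)) as [p [p0 pf]].
destruct (@fully_faithful_lift X (pull (copair (F0 f) c)) Y p (inlF (d0 X) P) f pf)
  as [i [i0 pi]].
- exact (eq_trans (f_equal (fun L => L \of inlF (d0 X) P) p0) (copair_inl _ _)).
- exists (pull (copair (F0 f) c)), i, (inrF (d0 X) P), p; rewrite i0.
  split; [apply sum_coproduct|]; split; [exact pf|]; split; [exact pi|].
  exact (eq_trans (f_equal (fun L => L \of inrF (d0 X) P) p0) (copair_inr _ _)).
Qed.

(** Only the object part of a lift has to be built: it is [a] on [X] and a strict lift on the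
    projective [P]. Full faithfulness of the trivial fibration supplies the rest. *)
Lemma adjoin_cof X Z P (i : dblfunctor X Z) (ir : functor P (d0 Z)) :
  projective P -> coproduct (F0 i) ir -> cof tau' i.
Proof.
intros Pp [cp ext] E B p pf pw a b e; simpl in *.
destruct (trivial_fibration_surjective pf pw Pp (F0 b \of ir)) as [x ex].
destruct (cp _ (F0 a) x) as [h0 [hl hr]].
destruct (@fully_faithful_lift Z E B p h0 b (proj1 pw)) as [h [eh h1]].
- apply ext; rewrite <- compF_assoc, ?hl, ?hr; [exact (f_equal (@F0 _ _) e) | exact ex].
- exists h; split; [|exact h1].
  apply (@fully_faithful_mono _ _ _ p); [exact (proj1 pw)| |].
  + simpl; rewrite eh; exact hl.
  + transitivity (comp_dbl (comp_dbl p h) i); [apply dbl_assoc|].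
    rewrite h1; symmetry; exact e.
Qed.

(** * Lifting inclusions with a fully faithful retraction against fibrations *)

Section Retraction.
Variables (X Z : dblcat) (P : cat) (r : dblfunctor Z X) (j : dblfunctor X Z)
  (ir : functor P (d0 Z)).
Hypotheses (Pp : projective P) (cp : coproduct (F0 j) ir) (rff : fully_faithful r)
  (rj : comp_dbl r j = id_dbl X).

Let rj0 : F0 r \of F0 j = idF (d0 X) := f_equal (@F0 X X) rj.
Let rj1 : F1 r \of F1 j = idF (d1 X) := f_equal (@F1 X X) rj.

(** The retraction [r] is a trivial fibration, strict preimages being given by [j]; two-out-of-three
    applies to [r] and [j], whose composite is the identity. *)
Lemma retraction_we : we tau' j.
Proof.
apply (@we_cancel_left X Z X j r).
- apply surjective_trivial_fibration; [exact rff|].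
  intros Q Qp y; exists (F0 j \of y); rewrite compF_assoc, rj0; apply compF_idl.
- rewrite rj; apply surjective_trivial_fibration.
  + apply elementwise_fully_faithful; split; simpl.
    * intros x y b d c; exists b; auto.
    * intros a a' d c e; exact e.
    * intros x y b d c; exists b; auto.
    * intros a a' d c e; exact e.
  + intros Q Qp y; exists y; apply compF_idl.
Qed.

(** Both double functors become [r] after applying [r], so fullness lifts the unit of [r] to [psi].
    Faithfulness of [r] yields naturality and shows that [psi] is a unit on [X]. *)
Lemma retraction_nat_iso : exists psi, nat_iso psi (id_dbl Z) (comp_dbl j r) /\
  psi \of F0 j = hunit \of F0 j.
Proof.
destruct (proj1 (fully_faithful_pts rff (d0 Z)) (idF _) (F0 j \of F0 r) (hunit \of F0 r))
  as [psi [d [c e]]]; simpl in *.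
- rewrite compF_idr, compF_assoc, src_hunit; apply compF_idl.
- rewrite !compF_assoc, rj0, tgt_hunit; reflexivity.
- exists psi; split; [split; [|split; [exact d|split; [exact c|]]]|].
  + destruct (@ff_reflects_inverse _ _ (pts_map (d0 Z) r) psi (hunit \of F0 r)) as [b [ib _]].
    * apply fully_faithful_pts; exact rff.
    * simpl; rewrite e; exact (@inverse_idm (pts (d0 Z) X) (F0 r)).
    * exists b; exact ib.
  + assert (k1 : @cod (pts (d1 Z) Z) (idF (d1 Z)) = @dom (pts (d1 Z) Z) (psi \of tgt)).
    { simpl; rewrite compF_assoc, d, compF_idr; symmetry; apply compF_idl. }
    assert (k2 : @cod (pts (d1 Z) Z) (psi \of src) = @dom (pts (d1 Z) Z) (F1 j \of F1 r)).
    { simpl; rewrite !compF_assoc, c, src_F, <- (compF_assoc _ src), src_F; symmetry; apply compF_assoc. }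
    apply (proj2 (fully_faithful_pts rff (d1 Z))).
    * rewrite !dom_tc by assumption; simpl; rewrite compF_assoc, d, compF_idr.
      symmetry; apply compF_idl.
    * rewrite !cod_tc by assumption; simpl.
      rewrite !compF_assoc, c, tgt_F, <- (compF_assoc _ tgt), tgt_F, compF_assoc; reflexivity.
    * rewrite !fmor_tc by assumption; simpl.
      rewrite !compF_assoc, e, rj1, compF_idl, compF_idr, <- !compF_assoc.
      transitivity (F1 r); [|symmetry].
      -- apply (@tc_idr (pts (d1 Z) X) (F1 r) (F0 r \of tgt)); symmetry; apply tgt_F.
      -- apply (@tc_idl (pts (d1 Z) X) (F1 r) (F0 r \of src)); symmetry; apply src_F.
  + apply (proj2 (fully_faithful_pts rff (d0 X))); simpl.
    * rewrite !compF_assoc, d, src_hunit; reflexivity.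
    * rewrite !compF_assoc, c, tgt_hunit, <- (compF_assoc _ (F0 r)), rj0, compF_idr, compF_idl.
      reflexivity.
    * rewrite !compF_assoc, e, hunit_F; reflexivity.
Qed.

Lemma retraction_lifts E B (p : dblfunctor E B) : fib tau' p -> lifts (C := DBLCAT) j p.
Proof.
intros pf a b e; simpl in *; rewrite fib_pts in pf.
destruct retraction_nat_iso as [psi [n psij]].
(* An isomorphism from [b] to [b j r], which equals [p a r]. *)
pose proof (nat_iso_postcomp b n) as nb; rewrite dbl_idr, dbl_assoc, <- e in nb.
destruct nb as [ib [sb [tb eb]]]; simpl in tb.
(* The isomorphism is lifted only on the summand [P], where projectivity allows it; on [X] it is a
   unit and lifts to a unit. *)
destruct (pf P Pp (F0 a \of (F0 r \of ir)) (F1 b \of psi \of ir)) as [th [ith [tth eth]]].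
- exact (invertible_fmor (precomp ir B) ib).
- simpl; rewrite compF_assoc, tb, <- !compF_assoc; reflexivity.
- simpl in tth, eth.
  destruct (coproduct_invertible (f := hunit \of F0 a) (g := th) cp) as [theta [it [tl tr]]].
  { exists (hunit \of F0 a); exact (@inverse_idm (pts (d0 X) E) (F0 a)). }
  { exact ith. }
  (* The lift is the conjugate of [a r] by [theta]. It restricts to [a] since [theta] is a unit on
     [X], and lies over [b] since [p] takes [theta] to [b psi]. *)
  destruct (@conj_exists Z E theta (comp_dbl a r)) as [h nh]; [exact it| |].
  { simpl; apply (proj2 cp); rewrite <- !compF_assoc, ?tl, ?tr.
    - rewrite rj0, compF_assoc, tgt_hunit, compF_idr; apply compF_idl.
    - exact tth. }
  exists h; split.
  + pose proof (nat_iso_precomp j nh) as nj; rewrite <- dbl_assoc, rj, dbl_idr in nj.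
    exact (conj_unique tl eq_refl nj (nat_iso_refl a)).
  + pose proof (nat_iso_postcomp p nh) as np; rewrite dbl_assoc in np.
    refine (conj_unique _ eq_refl np (conj ib (conj sb (conj tb eb)))).
    apply (proj2 cp); rewrite <- !compF_assoc.
    * rewrite tl, psij, !compF_assoc, !hunit_F, <- !compF_assoc; f_equal.
      exact (f_equal (@F0 _ _) e).
    * rewrite tr, eth; symmetry; apply compF_assoc.
Qed.

End Retraction.

(** * The two factorizations and the model structure *)

Lemma cof_trivial_fibration_factorization X Y (f : dblfunctor X Y) :
  exists Z (i : dblfunctor X Z) (p : dblfunctor Z Y),
    f = comp_dbl p i /\ cof tau' i /\ fib tau' p /\ we tau' p.
Proof.
destruct (free_cover (d0 Y)) as [c cs].
destruct (adjoin_objects f c) as [Z [i [ir [p [cp [pf [pi pc]]]]]]].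
exists Z, i, p; split; [auto|]; split; [exact (adjoin_cof (@free_projective (d0 Y)) cp)|].
apply surjective_trivial_fibration; [exact pf|].
(* Points of [d0 Y] over a projective category lift through the cover [c], which is [p] restricted
   to the adjoined summand. *)
intros P Pp y; destruct (Pp _ _ _ cs y) as [x ex].
exists (ir \of x); rewrite compF_assoc, pc; exact ex.
Qed.

Lemma trivial_cof_fibration_factorization X Y (f : dblfunctor X Y) :
  exists Z (i : dblfunctor X Z) (p : dblfunctor Z Y),
    f = comp_dbl p i /\ cof tau' i /\ we tau' i /\ fib tau' p /\
    forall E B (q : dblfunctor E B), fib tau' q -> lifts (C := DBLCAT) i q.
Proof.
destruct (free_cover (path0 f)) as [c cs].
pose proof (@free_projective (path0 f)) as Pp.
(* An adjoined object lies over a pair of [a] in [X] and an isomorphism [y -> f a]; the retraction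
   [r] sends it to [a]. *)
destruct (adjoin_objects (id_dbl X) (pb_fst _ _ \of c)) as [Z [j [ir [r [cp [rff [rj rc]]]]]]].
pose proof (f_equal (@F0 X X) rj) as rj0; simpl in rj0.
(* [phi] is the unit on [X] and the universal isomorphism [y -> f a] on the adjoined summand.
   Conjugating [f r] by it gives a [q] that equals [f] on [X] and takes the value [y] on adjoined
   objects. *)
destruct (coproduct_invertible (f := hunit \of F0 f)
  (g := iso1_incl Y \of (pb_snd _ _ \of c)) cp) as [phi [iphi [phil phir]]].
{ exists (hunit \of F0 f); exact (@inverse_idm (pts (d0 X) Y) (F0 f)). }
{ apply iso1_pt. }
destruct (@conj_exists Z Y phi (comp_dbl f r)) as [q nq]; [exact iphi| |].
{ simpl; apply (proj2 cp); rewrite <- !compF_assoc, ?phil, ?phir.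
  - rewrite rj0, compF_assoc, tgt_hunit, compF_idr; apply compF_idl.
  - rewrite rc, !compF_assoc, pb_commutes; reflexivity. }
exists Z, j, q; split; [|split; [|split; [|split]]].
- pose proof (nat_iso_precomp j nq) as nj; rewrite <- dbl_assoc, rj, dbl_idr in nj.
  symmetry; exact (conj_unique phil eq_refl nj (nat_iso_refl f)).
- exact (adjoin_cof Pp cp).
- exact (retraction_we rff rj).
- apply fib_pts; intros Q Qp z b ib bc; simpl in bc.
  destruct (nat_iso_composable nq) as [k1 k2]; destruct nq as [_ [sphi [tphi ephi]]].
  simpl in tphi.
  (* To lift [b] ending at [q z], it is composed with [phi] at [z]; the result ends at [f (r z)] and
     so is a point of [path0 f]. *)
  pose (phiz := phi \of z : mor (pts Q Y)).
  assert (iphiz : invertible (pts Q Y) phiz) by exact (invertible_fmor (precomp z Y) iphi).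
  assert (bphi : @cod (pts Q Y) b = dom phiz).
  { simpl; rewrite bc; unfold phiz; rewrite compF_assoc, sphi; reflexivity. }
  assert (cphi : cod phiz = F0 f \of (F0 r \of z)).
  { unfold phiz; simpl; rewrite !compF_assoc, tphi; reflexivity. }
  pose proof (invertible_comp bphi ib iphiz) as ig; destruct (pt_iso1 ig) as [g eg].
  assert (gc : F0 f \of (F0 r \of z) = iso_tgt Y \of g).
  { transitivity (@cod (pts Q Y) (tc b phiz)); [rewrite cod_tc by exact bphi; auto|].
    exact (eq_trans (f_equal (@cod (pts Q Y)) (eq_sym eg)) (compF_assoc _ _ _)). }
  (* The adjoined point [ir u] has the same image under [r] as [z], and [phi] there equals [b]
     followed by [phiz]. *)
  destruct (Qp _ _ _ cs (pb_pair _ g gc)) as [u eu].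
  assert (rz : F0 r \of (ir \of u) = F0 r \of z).
  { transitivity (pb_fst (F0 f) (iso_tgt Y) \of (c \of u)).
    - rewrite compF_assoc, rc; symmetry; apply compF_assoc.
    - refine (eq_trans (f_equal (compF _) eu) _); apply pb_fst_pair. }
  assert (phiz' : phi \of (ir \of u) = tc b phiz).
  { transitivity (iso1_incl Y \of (pb_snd (F0 f) (iso_tgt Y) \of (c \of u))).
    - rewrite compF_assoc, phir, <- !compF_assoc; reflexivity.
    - transitivity (iso1_incl Y \of g); [|exact eg]; apply f_equal.
      refine (eq_trans (f_equal (compF _) eu) _); apply pb_snd_pair. }
  (* The required lift of [b] is the arrow [al] from [ir u] to [z] over the unit of [r z]. *)
  destruct (proj1 (fully_faithful_pts rff Q) (ir \of u) z (hunit \of (F0 r \of z)))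
    as [al [ad [ac ae]]].
  { simpl; rewrite rz, compF_assoc, src_hunit; apply compF_idl. }
  { simpl; rewrite compF_assoc, tgt_hunit; apply compF_idl. }
  simpl in ad, ac, ae; exists al; split; [|split; [exact ac|]].
  + destruct (@ff_reflects_inverse _ _ (pts_map Q r) al (hunit \of (F0 r \of z))) as [be [ibe _]].
    * apply fully_faithful_pts; exact rff.
    * simpl; rewrite ae; exact (@inverse_idm (pts Q X) (F0 r \of z)).
    * exists be; exact ibe.
  (* Naturality of [phi] at [al] equates [q al] followed by [phiz] with [b] followed by [phiz], and
     [phiz] cancels. *)
  + simpl; apply (@tc_cancel_right (pts Q Y) _ _ phiz); [exact iphiz| |exact bphi|].
    * simpl; unfold phiz; rewrite !compF_assoc, tgt_F, sphi, <- compF_assoc, ac; reflexivity.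
    * rewrite <- phiz'.
      apply (f_equal (fmor (precomp al Y))) in ephi.
      rewrite !fmor_tc in ephi by assumption; simpl in ephi.
      rewrite <- !compF_assoc, ad, ac, ae, (compF_assoc (F1 f)), hunit_F in ephi.
      etransitivity; [exact ephi|]; rewrite <- compF_assoc; apply (@tc_idr (pts Q Y)).
      rewrite phiz', cod_tc by exact bphi; symmetry; exact cphi.
- intros E B s sf; exact (retraction_lifts Pp cp rff rj sf).
Qed.

Lemma lifts_retract (C : category) (A B A' B' E D : obj C)
    (f : hom A B) (g : hom A' B') (p : hom E D) :
  @is_retract C _ _ _ _ f g -> lifts g p -> lifts f p.
Proof.
intros [i [r [j [q [ri [qj [gi fr]]]]]]] L a b e.
destruct (L (a \oc r) (b \oc q)) as [h [h1 h2]].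
- rewrite compc_assoc, e, <- !compc_assoc, fr; reflexivity.
- exists (h \oc j); split.
  + rewrite <- compc_assoc, <- gi, compc_assoc, h1, <- compc_assoc, ri; apply compc_idr.
  + rewrite compc_assoc, h2, <- compc_assoc, qj; apply compc_idr.
Qed.

Lemma retract_argument (C : category) (A B Z : obj C) (i : hom A B) (j : hom A Z)
    (p : hom Z B) : i = p \oc j -> lifts i p -> @is_retract C _ _ _ _ i j.
Proof.
intros e L; destruct (L j (idc B)) as [h [h1 h2]].
- rewrite compc_idl; symmetry; exact e.
- exists (idc A), (idc A), h, p; repeat split.
  + apply compc_idl.
  + exact h2.
  + rewrite compc_idr; symmetry; exact h1.
  + rewrite compc_idr; exact e.
Qed.

(** Factor [i] as [q] after [j]. By two-out-of-three [q] is a trivial fibration, so the cofibration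
    [i] lifts against it, is a retract of [j], and inherits the lifting property of [j] against
    fibrations. *)
Lemma trivial_cof_lifts_fib A B E D (i : dblfunctor A B) (p : dblfunctor E D) :
  cof tau' i -> we tau' i -> fib tau' p -> lifts (C := DBLCAT) i p.
Proof.
intros ic iw pf.
destruct (trivial_cof_fibration_factorization i) as [Z [j [q [e [jc [jw [qf jl]]]]]]].
apply (@lifts_retract DBLCAT _ _ _ _ _ _ i j p); [|exact (jl _ _ p pf)].
apply (@retract_argument DBLCAT _ _ _ i j q e); apply ic; [exact qf|].
apply (we_cancel_right jw); rewrite <- e; exact iw.
Qed.

Theorem theorem8p44 : model_structure DBLCAT (we tau') (fib tau') (cof tau').
Proof.
split.
- exact dblcat_complete.
- exact dblcat_cocomplete.
- intros X Y Z f g; split; [|split].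
  + apply we_comp.
  + apply we_cancel_right.
  + apply we_cancel_left.
- exact we_retract.
- exact fib_retract.
- intros X Y X' Y' f g R gc E B p pf pw.
  exact (lifts_retract R (gc _ _ p pf pw)).
- intros A B X Y i p ic pf pw; exact (ic X Y p pf pw).
- exact trivial_cof_lifts_fib.
- exact cof_trivial_fibration_factorization.
- intros X Y f; destruct (trivial_cof_fibration_factorization f)
    as [Z [i [p [e [ic [iw [pf _]]]]]]].
  exists Z, i, p; auto.
Qed.
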